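(* Let $p\ge 2$ and $\nu\ge 1$ be integers, let $\omega\in\mathbb R^\nu$ be rationally independent, and write $\langle n\rangle=\sum_{j=1}^\nu n_j\omega_j$ for $n\in\mathbb Z^\nu$. Suppose the Fourier coefficients $\hat u(n)\in\mathbb C$, $n\in\mathbb Z^\nu$, of the initial data satisfy the polynomial decay condition $$|\hat u(n)|\le \mathtt A^{\frac1{p-1}}(1+|n|)^{-\mathtt r},\qquad \forall n\in\mathbb Z^\nu,$$ where $\mathtt A>0$, $\mathtt r$ is a sufficiently large positive constant, and $1\le\nu<\frac{\mathtt r}{4}-2$. Then the quasi-periodic Cauchy problem $$u_t-u_{xxt}+u_x+u^{p-1}u_x=0,\qquad u(0,x)=\sum_{n\in\mathbb Z^\nu}\hat u(n)e^{i\langle n\rangle x},\qquad x\in\mathbb R,$$ has a unique spatially quasi-periodic solution in the classical sense on the time interval $[0,\mathcal L_p']$, where $$\mathcal L_p':=\left(1-\frac1p\right)^{p-1}\mathtt A^{-1}\,\mathfrak b\!\left(\frac{\mathtt r}{2};\nu\right)^{-1},\qquad \mathfrak b(\mathtt s;\nu):=1+\sum_{j=1}^{\nu}\binom{\nu}{j}2^{j}j^{-\mathtt s}\left\{\zeta\!\left(\frac{\mathtt s}{j}\right)\right\}^{j},$$ and $\zeta(\mathtt s)=\sum_{n=1}^\infty n^{-\mathtt s}$ is the Riemann zeta function.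
   Context: $|n|=\sum_{j=1}^\nu|n_j|$ for $n\in\mathbb Z^\nu$. The vector $\omega$ is rationally independent (non-resonant) if $\langle n\rangle=0$ with $n\in\mathbb Z^\nu$ implies $n=0$. A spatially quasi-periodic solution in the classical sense on $[0,L]$ is a function of the form $u(t,x)=\sum_{n\in\mathbb Z^\nu}\hat u(t,n)e^{i\langle n\rangle x}$, with each $\hat u(\cdot,n):[0,L]\to\mathbb C$ continuously differentiable, such that the Fourier series of $u,u_t,u_x,u_{xxt},u^{p-1}u_x$ (obtained by termwise differentiation and by the Cauchy product) converge absolutely and uniformly on $[0,L]\times\mathbb R$, the equation holds at every point $(t,x)\in[0,L]\times\mathbb R$, and $u(0,x)$ equals the given initial data. Solutions may be complex valued. *)

(* Defs.v *)
(* The reals are an arbitrary [R : realType]; the complex numbers are [R[i]],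
   taken through the regular alias [R[i]^o], which is the one that carries the
   topology of the modulus. *)
From HB Require Import structures.
From mathcomp Require Import all_boot all_order all_algebra.
From mathcomp Require Import finmap.
From mathcomp Require Import all_classical all_reals all_analysis.
From mathcomp Require Import complex.
From mathcomp Require Export summability.

Set Implicit Arguments.
Unset Strict Implicit.
Unset Printing Implicit Defensive.

Import Order.TTheory GRing.Theory Num.Theory numFieldNormedType.Exports.

Local Open Scope classical_set_scope.
Local Open Scope complex_scope.
Local Open Scope ring_scope.

Notation cplx R := (R[i]^o)%type.

Notation cmod := ComplexField.Normc.normc.

Section Constants.
Variable R : realType.

Definition zeta (s : R) : R :=
  limn (series (fun k : nat => k.+1%:R `^ (- s))).

Definition bfrak (s : R) (nu : nat) : R :=
  1 + \sum_(1 <= j < nu.+1)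
        'C(nu, j)%:R * 2 ^+ j * j%:R `^ (- s) * zeta (s / j%:R) ^+ j.

Definition lifespan (p nu : nat) (A r : R) : R :=
  (1 - p%:R^-1) ^+ p.-1 * A^-1 * (bfrak (r / 2) nu)^-1.

End Constants.

Definition l1norm (nu : nat) (n : 'rV[int]_nu) : nat := \sum_j `|n ord0 j|%N.

Section QuasiPeriodic.
Variables (R : realType) (nu : nat) (omega : 'rV[R]_nu).

Definition freq (n : 'rV[int]_nu) : R := \sum_j (n ord0 j)%:~R * omega ord0 j.

Definition nonresonant : Prop := forall n, freq n = 0 -> n = 0.

Definition expi (y : R) : cplx R := (cos y +i* sin y)%C.

(* [totally] is the filter of finite subsets of Z^nu ordered by inclusion, so
   no enumeration of Z^nu enters; [sum] is the limit along it. *)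
Definition abs_unif_sum (T : choiceType) (D : set T)
    (f : 'rV[int]_nu -> T -> cplx R) (s : T -> cplx R) : Prop :=
  (forall z, D z -> esum.summable setT (fun n => (cmod (f n z))%:E)) /\
  {uniform D, (fun J z => partial_sum (f^~ z) J) @ totally --> s}.

(* The value is meaningful when [a] and [b] are absolutely summable, which
   [solution_data] below guarantees wherever the product is used. *)
Definition cauchy_prod (a b : 'rV[int]_nu -> cplx R) (n : 'rV[int]_nu) :
    cplx R :=
  sum (fun m => a m * b (n - m)).

Definition dx_coef (a : 'rV[int]_nu -> cplx R) (n : 'rV[int]_nu) : cplx R :=
  'i%C * (freq n)%:C * a n.

(* Coefficients of u^{p-1} u_x, for u with coefficients [a]. *)
Definition nonlin_coef (p : nat) (a : 'rV[int]_nu -> cplx R) :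
    'rV[int]_nu -> cplx R :=
  iter p.-1 (cauchy_prod a) (dx_coef a).

Definition qp_term (a : R -> 'rV[int]_nu -> cplx R) (n : 'rV[int]_nu)
    (z : R * R) : cplx R :=
  a z.1 n * expi (freq n * z.2).

Definition qp_sum (a : 'rV[int]_nu -> cplx R) (x : R) : cplx R :=
  sum (fun n => a n * expi (freq n * x)).

(* Derivative relative to [D]: one-sided at the endpoints of an interval. *)
Definition deriv_on (D : set R) (f df : R -> cplx R) : Prop :=
  forall t, D t ->
    (fun s => (f s - f t) / (s - t)%:C) @ within D t^' --> df t.

Definition C1_on (D : set R) (f df : R -> cplx R) : Prop :=
  deriv_on D f df /\ {within D, continuous df}.

(* Points are pairs (t, x).  The functions [ut], [ux], [uxx], [uxxt] are the
   genuine partial derivatives of [u], and [ut], [ux], [uxxt] are at the same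
   time the sums of the termwise differentiated series. *)
Record solution_data (p : nat) (L : R) (u0 : R -> cplx R)
    (u ut ux uxx uxxt : R * R -> cplx R)
    (c dc : R -> 'rV[int]_nu -> cplx R) : Prop := SolutionData {
  sol_C1 : forall n, C1_on `[0, L] (c^~ n) (dc^~ n);

  sol_u : abs_unif_sum (`[0, L] `*` setT) (qp_term c) u;
  sol_ut : abs_unif_sum (`[0, L] `*` setT) (qp_term dc) ut;
  sol_ux : abs_unif_sum (`[0, L] `*` setT)
             (qp_term (fun t => dx_coef (c t))) ux;
  sol_uxxt : abs_unif_sum (`[0, L] `*` setT)
               (qp_term (fun t => dx_coef (dx_coef (dc t)))) uxxt;
  sol_nonlin : abs_unif_sum (`[0, L] `*` setT)
                 (qp_term (fun t => nonlin_coef p (c t)))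
                 (fun z => u z ^+ p.-1 * ux z);

  sol_dt_u : forall x,
    deriv_on `[0, L] (fun t => u (t, x)) (fun t => ut (t, x));
  sol_dx_u : forall t, 0 <= t <= L ->
    deriv_on setT (fun x => u (t, x)) (fun x => ux (t, x));
  sol_dx_ux : forall t, 0 <= t <= L ->
    deriv_on setT (fun x => ux (t, x)) (fun x => uxx (t, x));
  sol_dt_uxx : forall x,
    deriv_on `[0, L] (fun t => uxx (t, x)) (fun t => uxxt (t, x));

  sol_eq : forall t x, 0 <= t <= L ->
    ut (t, x) - uxxt (t, x) + ux (t, x) + u (t, x) ^+ p.-1 * ux (t, x) = 0;
  sol_init : forall x, u (0, x) = u0 x
}.

Definition classical_solution (p : nat) (L : R) (u0 : R -> cplx R)
    (u : R * R -> cplx R) : Prop :=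
  exists (ut ux uxx uxxt : R * R -> cplx R) (c dc : R -> 'rV[int]_nu -> cplx R),
    solution_data p L u0 u ut ux uxx uxxt c dc.

End QuasiPeriodic.

(* Main.v *)
Require Import Defs.
From mathcomp Require Import all_boot all_order all_algebra.
From mathcomp Require Import finmap.
From mathcomp Require Import all_classical all_reals all_analysis.
From mathcomp Require Import complex ring lra zify.
Import Order.TTheory GRing.Theory Num.Theory numFieldNormedType.Exports.
Local Open Scope classical_set_scope.
Local Open Scope ring_scope.

(** Writing u as the sum of c(t,n) e^(i<n>x), the equation becomes a system for
    the coefficients,
      c' = - i s(n) (c + c^p / p),   s(n) = <n> / (1 + <n>^2),
    where c^p is a convolution power: u^(p-1) u_x is the derivative of u^p / p
    ([nonlin_coefE]), and the inverse of 1 - d^2 absorbs that derivative.  Since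
    |s(n)| <= 1/2 ([symbol_le]), this is an ordinary differential equation with a
    locally Lipschitz right-hand side in l^1(Z^nu), for every omega.

    Existence.  The linear part rotates each mode and costs nothing, so Picard's
    iteration is run with only the nonlinear term frozen.  It is controlled by
    majorants B_(k+1)(n) = |uhat(n)| + (L / 2p) (B_k)^p(n) that do not depend on
    time ([iterateB_le]): they increase, and stay in the ball of radius rho of
    l^1 with weight (1 + |n|)^2 as soon as y0 + (L / 2p) rho^p <= rho, where y0
    is the weighted norm of the data ([majorant_ok]).  Their limit dominates the
    limit of the iterates, which solves the system ([solution_exists]); the
    weight pays for two derivatives in x, so all series of the definition
    converge by the Weierstrass test and can be differentiated term by term
    ([classical_of_coefficients]).

    The lifespan.  By the decay assumption y0 <= A^(1/(p-1)) S, where S is the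
    sum of (1 + |n|)^(2-r) over Z^nu.  As r > 4 nu + 8, the terms n <> 0 sum up
    to a quantity that tends to 0 with 1 / r uniformly in nu, so S <= 1 + 1/(2p)
    for r beyond a bound that depends on p alone ([weight_decay_sum]); hence
    S^(p-1) <= 2.  With rho = y0 p / (p-1) and b >= 1, the length
    L = (1 - 1/p)^(p-1) / (A b) gives (L / 2p) rho^p <= rho / p = rho - y0
    ([picard_radius]).

    Uniqueness.  A classical solution has absolutely summable coefficients at
    each time.  By non-resonance a series that vanishes identically has zero
    coefficients ([qp_sum_eq0]), so both the equation and the initial datum hold
    coefficient by coefficient.  Uniform convergence bounds the l^1 norm of the
    coefficients uniformly in time ([solution_bounded]), and iterating the
    Lipschitz estimate shows that two solutions coincide ([ode_unique]).

    The analytic tool behind all exchanges of limits is dominated convergence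
    for sums along an arbitrary filter ([tannery]). *)

Set Implicit Arguments.
Unset Strict Implicit.
Unset Printing Implicit Defensive.

#[local] Existing Instance totally_filter.

(** * Modulus and convergence in the complex numbers *)

Section Modulus.
Variable R : realType.
Implicit Types x y z : cplx R.

Lemma normE z : `|z| = (cmod z)%:C%C.
Proof. by []. Qed.

Lemma cmod_ge0 z : 0 <= cmod z.
Proof. by rewrite -ler0c -normE normr_ge0. Qed.

Lemma cmodD x y : cmod (x + y) <= cmod x + cmod y.
Proof. exact: le_normcD. Qed.

Lemma cmodN x : cmod (- x) = cmod x.
Proof. exact: normcN. Qed.

Lemma cmodM x y : cmod (x * y) = cmod x * cmod y.
Proof. exact: ComplexField.Normc.normcM. Qed.

Lemma cmod0 : cmod (0 : cplx R) = 0.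
Proof. exact: ComplexField.Normc.normc0. Qed.

Lemma cmodV x : cmod x^-1 = (cmod x)^-1.
Proof. exact: ComplexField.Normc.normcV. Qed.

Lemma cmod_eq0 x : cmod x = 0 -> x = 0.
Proof. exact: ComplexField.Normc.eq0_normc. Qed.

Lemma cmodB x y : cmod (x - y) <= cmod x + cmod y.
Proof. by rewrite -(cmodN y) cmodD. Qed.

Lemma cmodBC x y : cmod (x - y) = cmod (y - x).
Proof. by rewrite -cmodN opprB. Qed.

Lemma cmod_real (a : R) : cmod (a%:C%C : cplx R) = `|a|.
Proof. by rewrite /= expr0n /= addr0 sqrtr_sqr. Qed.

Lemma cmod_i : cmod ('i%C : cplx R) = 1.
Proof. by rewrite /= expr0n /= add0r expr1n sqrtr1. Qed.

Lemma cmod_nat n : cmod (n%:R : cplx R) = n%:R.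
Proof.
have -> : (n%:R : cplx R) = (n%:R : R)%:C%C by rewrite rmorph_nat.
by rewrite cmod_real normr_nat.
Qed.

Lemma Re_le_cmod z : `|complex.Re z| <= cmod z.
Proof. by rewrite -lecR; exact: normc_ge_Re. Qed.

Lemma Im_le_cmod z : `|complex.Im z| <= cmod z.
Proof.
case: z => a b /=; rewrite -[leLHS]sqrtr_sqr ler_wsqrtr //.
by rewrite lerDr sqr_ge0.
Qed.

Lemma cmod_le_ReIm z : cmod z <= `|complex.Re z| + `|complex.Im z|.
Proof.
rewrite {1}[z]complexE; apply: le_trans (cmodD _ _) _.
by rewrite cmodM cmod_i mul1r !cmod_real.
Qed.

Lemma cmod_sum (I : Type) (s : seq I) (P : pred I) (f : I -> cplx R) :
  cmod (\sum_(i <- s | P i) f i) <= \sum_(i <- s | P i) cmod (f i).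
Proof.
elim/big_rec2: _ => [|i x y _ h]; first by rewrite cmod0.
by apply: le_trans (cmodD _ _) _; rewrite lerD2l.
Qed.

Lemma ReD x y : complex.Re (x + y) = complex.Re x + complex.Re y.
Proof. by case: x y => [a b] [c d]. Qed.

Lemma ImD x y : complex.Im (x + y) = complex.Im x + complex.Im y.
Proof. by case: x y => [a b] [c d]. Qed.

Lemma ReN x : complex.Re (- x) = - complex.Re x.
Proof. by case: x. Qed.

Lemma ImN x : complex.Im (- x) = - complex.Im x.
Proof. by case: x. Qed.

Lemma Re_sum (I : Type) (s : seq I) (P : pred I) (f : I -> cplx R) :
  complex.Re (\sum_(i <- s | P i) f i) = \sum_(i <- s | P i) complex.Re (f i).
Proof. by elim/big_rec2: _ => // i x y _ <-; rewrite ReD. Qed.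

Lemma Im_sum (I : Type) (s : seq I) (P : pred I) (f : I -> cplx R) :
  complex.Im (\sum_(i <- s | P i) f i) = \sum_(i <- s | P i) complex.Im (f i).
Proof. by elim/big_rec2: _ => // i x y _ <-; rewrite ImD. Qed.

Lemma Re_Cmul (a : R) x : complex.Re (a%:C%C * x) = a * complex.Re x.
Proof. by case: x => b c /=; rewrite mul0r subr0. Qed.

Lemma rC_sum (I : Type) (s : seq I) (P : pred I) (f : I -> R) :
  (\sum_(i <- s | P i) f i)%:C%C = \sum_(i <- s | P i) (f i)%:C%C :> cplx R.
Proof. by rewrite rmorph_sum. Qed.

Lemma rC_sub (a b : R) : (a - b)%:C%C = a%:C%C - b%:C%C :> cplx R.
Proof. exact: rmorphB. Qed.

Lemma rC_mul (a b : R) : (a * b)%:C%C = a%:C%C * b%:C%C :> cplx R.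
Proof. exact: rmorphM. Qed.

Lemma rC_inv (a : R) : (a^-1)%:C%C = (a%:C%C)^-1 :> cplx R.
Proof. exact: fmorphV. Qed.

Section Convergence.
Variables (T : Type) (F : set_system T).

(** The filter of neighbourhoods of a point of [R[i]^o] is indexed by complex
    radii; this characterization trades them for real ones. *)
Lemma cvg_cmodP {FF : Filter F} (f : T -> cplx R) (l : cplx R) :
  f @ F --> l <->
  forall e : R, 0 < e -> \forall t \near F, cmod (l - f t) < e.
Proof.
split=> [/cvgrPdist_lt h e e0|h].
  have /h : 0 < e%:C%C :> R[i] by rewrite (ltcR 0).
  by apply: filterS => x; rewrite normE ltcR.
apply/cvgrPdist_lt => -[e e'].
rewrite ltcE /= => /andP[/eqP -> e0].
by apply: filterS (h e e0) => x; rewrite normE -ltcR.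
Qed.

Lemma cvg_cmod_le {FF : ProperFilter F} (f : T -> cplx R) (l : cplx R) (e : R) :
  f @ F --> l -> (\forall t \near F, cmod (f t) <= e) -> cmod l <= e.
Proof.
move=> /cvg_cmodP fl fe; apply/ler_addgt0Pr => d d0.
have [x [h1 h2]] := filter_ex (filterI (fl _ d0) fe).
rewrite -[l](subrK (f x)); apply: le_trans (cmodD _ _) _.
by rewrite addrC lerD // ltW.
Qed.

Lemma cvg_cplx_unique {FF : ProperFilter F} (f : T -> cplx R) (l l' : cplx R) :
  f @ F --> l -> f @ F --> l' -> l = l'.
Proof.
move=> h1 h2; have hs := @norm_hausdorff _ (cplx R).
by rewrite -(cvg_lim hs h1) -(cvg_lim hs h2).
Qed.

Lemma cvg_rC {FF : Filter F} (f : T -> R) (l : R) :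
  f @ F --> l -> (fun t => (f t)%:C%C : cplx R) @ F --> (l%:C%C : cplx R).
Proof.
move=> /cvgrPdist_lt h; apply/cvg_cmodP => e e0.
by apply: filterS (h e e0) => x hx; rewrite -rmorphB cmod_real.
Qed.

Lemma cvg_Re {FF : Filter F} (f : T -> cplx R) (l : cplx R) :
  f @ F --> l -> (fun t => complex.Re (f t)) @ F --> complex.Re l.
Proof.
move=> /cvg_cmodP h; apply/cvgrPdist_lt => e e0.
apply: filterS (h e e0) => x; apply: le_lt_trans.
by rewrite -ReN -ReD Re_le_cmod.
Qed.

Lemma cvg_Im {FF : Filter F} (f : T -> cplx R) (l : cplx R) :
  f @ F --> l -> (fun t => complex.Im (f t)) @ F --> complex.Im l.
Proof.
move=> /cvg_cmodP h; apply/cvgrPdist_lt => e e0.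
apply: filterS (h e e0) => x; apply: le_lt_trans.
by rewrite -ImN -ImD Im_le_cmod.
Qed.

Lemma cvg_cplxD {FF : Filter F} (f g : T -> cplx R) a b :
  f @ F --> a -> g @ F --> b -> (fun t => f t + g t) @ F --> a + b.
Proof. exact: cvgD. Qed.

Lemma cvg_cplxM {FF : Filter F} (f g : T -> cplx R) (a b : cplx R) :
  f @ F --> a -> g @ F --> b -> (fun t => f t * g t) @ F --> a * b.
Proof. exact: cvgM. Qed.

End Convergence.
End Modulus.

#[global] Arguments ComplexField.Normc.normc {R} x : simpl never.

(** * Sums over an arbitrary index set *)

Section Summability.
Variables (R : realType) (I : choiceType).
Implicit Types (M : I -> R) (f g : I -> cplx R) (J K : {fset I}).

Lemma partial_sumE (V : zmodType) (f : I -> V) J :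
  partial_sum f J = \sum_(i <- J) f i.
Proof. by rewrite /partial_sum big_seq_fsetE. Qed.

(** For nonnegative [M] this says that the sum of [M] is at most [C], without
    naming that sum. *)
Definition sum_le M (C : R) := forall J, \sum_(i <- J) M i <= C.

Definition abs_summable f := exists C, sum_le (fun i => cmod (f i)) C.

Lemma totally_supset J : totally [set K | (J `<=` K)%fset].
Proof. by exists J. Qed.

Lemma sum_fsetU J K (V : zmodType) (f : I -> V) : [disjoint J & K]%fset ->
  \sum_(i <- (J `|` K)%fset) f i = \sum_(i <- J) f i + \sum_(i <- K) f i.
Proof.
move=> dJK; rewrite (big_fsetID _ (mem J)) /=; congr (_ + _).
  apply: eq_fbigl => i; rewrite !inE /=.
  by case: (i \in J); rewrite ?andbT ?andbF.
apply: eq_fbigl => i; rewrite !inE /=.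
have /fdisjointP h := dJK.
case iJ: (i \in J); rewrite /= ?andbT ?andbF //.
by rewrite (negbTE (h _ iJ)).
Qed.

Lemma fdisjoint_compl J K : [disjoint J & (K `\` J)]%fset.
Proof. by apply/fdisjointP => i iJ; rewrite !inE iJ. Qed.

Lemma sum_fsetD J K (V : zmodType) (f : I -> V) : (J `<=` K)%fset ->
  \sum_(i <- K) f i = \sum_(i <- J) f i + \sum_(i <- (K `\` J)%fset) f i.
Proof.
move=> /fsubsetP JK; rewrite -sum_fsetU ?fdisjoint_compl //.
apply: eq_fbigl => i; rewrite !inE.
by case iJ: (i \in J) => //=; rewrite JK.
Qed.

Lemma sum_le_sub M J K : (forall i, 0 <= M i) -> (J `<=` K)%fset ->
  \sum_(i <- J) M i <= \sum_(i <- K) M i.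
Proof.
by move=> M0 JK; rewrite (sum_fsetD _ JK) lerDl sumr_ge0.
Qed.

Lemma sum_le_ub M C i : (forall i, 0 <= M i) -> sum_le M C -> M i <= C.
Proof. by move=> M0 /(_ [fset i]%fset); rewrite big_seq_fset1. Qed.

Lemma sum_le_ge0 M C : sum_le M C -> 0 <= C.
Proof. by move=> /(_ fset0); rewrite big_seq_fset0. Qed.

Lemma sum_le_mono M M' C : (forall i, M i <= M' i) -> sum_le M' C -> sum_le M C.
Proof. by move=> h h' J; apply: le_trans (h' J); apply: ler_sum. Qed.

Lemma sum_leZ M C k : 0 <= k -> sum_le M C -> sum_le (fun i => k * M i) (k * C).
Proof. by move=> k0 h J; rewrite -mulr_sumr ler_wpM2l. Qed.

Lemma sum_leD M M' C C' : sum_le M C -> sum_le M' C' ->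
  sum_le (fun i => M i + M' i) (C + C').
Proof. by move=> h h' J; rewrite big_split lerD. Qed.

Lemma nonneg_sum_cvg M C : (forall i, 0 <= M i) -> sum_le M C ->
  (fun J => \sum_(i <- J) M i) @ totally -->
  sup (range (fun J => \sum_(i <- J) M i)).
Proof.
move=> M0 MC; set S := range _; set s := sup _.
have hS : has_sup S.
  by split; [exists (\sum_(i <- fset0) M i), fset0|exists C => _ [J _ <-]].
apply/cvgrPdist_lt => e e0.
have [_ [J _ <-] hJ] := sup_adherent e0 hS.
apply: filterS (totally_supset J) => K /= JK.
have h : \sum_(i <- K) M i <= s.
  by apply: sup_upper_bound => //; exists K.
rewrite ger0_norm ?subr_ge0 // ltrBlDr -ltrBlDl; apply: lt_le_trans hJ _.
exact: sum_le_sub.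
Qed.

(** All exchanges of limits below rest on this tail estimate: [J0] is chosen so
    that its partial sum nearly attains the supremum of the partial sums. *)
Lemma sum_le_tail M C : (forall i, 0 <= M i) -> sum_le M C ->
  forall e, 0 < e -> exists J0, forall K, [disjoint J0 & K]%fset ->
    \sum_(i <- K) M i <= e.
Proof.
move=> M0 MC e e0; set S := range (fun J => \sum_(i <- J) M i).
have hS : has_sup S.
  by split; [exists (\sum_(i <- fset0) M i), fset0|exists C => _ [J _ <-]].
have [_ [J _ <-] hJ] := sup_adherent e0 hS.
exists J => K dJK.
have : \sum_(i <- (J `|` K)%fset) M i <= sup S.
  by apply: sup_upper_bound => //; exists (J `|` K)%fset.
by rewrite sum_fsetU //; move: hJ; lra.
Qed.

(** The real part of [f i] is the difference of the nonnegative numbers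
    |f i| + Re (f i) and |f i|, whose partial sums are nondecreasing and bounded
    along the finite subsets; likewise for the imaginary part. *)
Lemma abs_summable_cvg f : abs_summable f ->
  (fun J => \sum_(i <- J) f i) @ totally --> sum f.
Proof.
move=> [C fC].
have hM : sum_le (fun i => 2 * cmod (f i)) (2 * C) by exact: sum_leZ.
have cM := nonneg_sum_cvg (fun i => cmod_ge0 (f i)) fC.
have part (phi : cplx R -> R) : (forall z, `|phi z| <= cmod z) ->
    exists a : R, (fun J => \sum_(i <- J) phi (f i)) @ totally --> a.
  move=> hphi.
  have g0 i : 0 <= cmod (f i) + phi (f i).
    by have := hphi (f i); rewrite ler_norml; lra.
  have gC : sum_le (fun i => cmod (f i) + phi (f i)) (2 * C).
    apply: sum_le_mono hM => i.
    by have := hphi (f i); rewrite ler_norml; lra.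
  move: (nonneg_sum_cvg g0 gC) cM; set s1 := sup _; set s2 := sup _ => c1 c2.
  exists (s1 - s2); apply: cvg_trans (cvgB c1 c2).
  apply: near_eq_cvg; apply: nearW => J.
  by rewrite !fctE -sumrB; apply: eq_bigr => i _; rewrite addrAC subrr add0r.
have [a ha] := part (@complex.Re R) (@Re_le_cmod R).
have [b hb] := part (@complex.Im R) (@Im_le_cmod R).
have h : (fun J => \sum_(i <- J) f i) @ totally -->
    ((a%:C + 'i * b%:C)%C : cplx R).
  apply: cvg_trans (cvg_cplxD (cvg_rC ha) (cvg_cplxM (cvg_cst _) (cvg_rC hb))).
  apply: near_eq_cvg; apply: nearW => J /=.
  rewrite !rC_sum mulr_sumr -big_split /=.
  by apply: eq_bigr => i _; rewrite -complexE.
rewrite /sum; have -> : partial_sum f = (fun J => \sum_(i <- J) f i).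
  by apply/funext => J; rewrite partial_sumE.
by rewrite (cvg_lim (@norm_hausdorff _ (cplx R)) h).
Qed.

Lemma sum_eq_lim f (l : cplx R) :
  (fun J => \sum_(i <- J) f i) @ totally --> l -> sum f = l.
Proof.
rewrite /sum; have -> : partial_sum f = (fun J => \sum_(i <- J) f i).
  by apply/funext => J; rewrite partial_sumE.
by move=> h; rewrite (cvg_lim (@norm_hausdorff _ (cplx R)) h).
Qed.

Lemma eq_sum f g : f =1 g -> sum f = sum g.
Proof. by move=> h; congr sum; apply/funext. Qed.

Lemma abs_summable_le f M C :
  (forall i, cmod (f i) <= M i) -> sum_le M C -> abs_summable f.
Proof. by move=> h hM; exists C; apply: sum_le_mono hM. Qed.

Lemma abs_summableD f g : abs_summable f -> abs_summable g ->
  abs_summable (fun i => f i + g i).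
Proof.
move=> [C fC] [D gD]; apply: (abs_summable_le _ (sum_leD fC gD)) => i.
exact: cmodD.
Qed.

Lemma abs_summableZ k f : abs_summable f -> abs_summable (fun i => k * f i).
Proof.
move=> [C fC]; apply: (abs_summable_le _ (sum_leZ (cmod_ge0 k) fC)) => i.
by rewrite cmodM.
Qed.

Lemma abs_summableN f : abs_summable f -> abs_summable (fun i => - f i).
Proof. by move=> [C fC]; exists C => J; under eq_bigr do rewrite cmodN. Qed.

Lemma abs_summableB f g : abs_summable f -> abs_summable g ->
  abs_summable (fun i => f i - g i).
Proof. by move=> hf hg; apply: abs_summableD hf (abs_summableN hg). Qed.

Lemma sumD f g : abs_summable f -> abs_summable g ->
  sum (fun i => f i + g i) = sum f + sum g.
Proof.
move=> /abs_summable_cvg hf /abs_summable_cvg hg; apply: sum_eq_lim.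
apply: cvg_trans (cvg_cplxD hf hg); apply: near_eq_cvg; apply: nearW => J.
by rewrite big_split.
Qed.

Lemma sumZ k f : abs_summable f -> sum (fun i => k * f i) = k * sum f.
Proof.
move=> /abs_summable_cvg hf; apply: sum_eq_lim.
apply: cvg_trans (cvg_cplxM (cvg_cst k) hf); apply: near_eq_cvg.
by apply: nearW => J; rewrite mulr_sumr.
Qed.

Lemma sumB f g : abs_summable f -> abs_summable g ->
  sum (fun i => f i - g i) = sum f - sum g.
Proof.
move=> hf hg; rewrite sumD //; last exact: abs_summableN.
congr (_ + _); under eq_sum do rewrite -mulN1r.
by rewrite sumZ // mulN1r.
Qed.

Lemma sum0 : sum (fun _ : I => 0 : cplx R) = 0.
Proof.
apply: sum_eq_lim; under eq_fun do rewrite big1 //.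
exact: cvg_cst.
Qed.

Lemma sum_tail_le f J0 e : abs_summable f ->
  (forall K, [disjoint J0 & K]%fset -> \sum_(i <- K) cmod (f i) <= e) ->
  cmod (sum f - \sum_(i <- J0) f i) <= e.
Proof.
move=> /abs_summable_cvg hf he.
have h : (fun J => \sum_(i <- J) f i - \sum_(i <- J0) f i) @ totally -->
    (sum f - \sum_(i <- J0) f i : cplx R).
  exact: cvg_cplxD hf (cvg_cst _).
apply: (cvg_cmod_le h).
apply: filterS (totally_supset J0) => K /= JK.
rewrite (sum_fsetD _ JK) addrAC subrr add0r.
by apply: le_trans (cmod_sum _ _ _) _; apply: he; rewrite fdisjoint_compl.
Qed.

Lemma cmod_sum_le f C : sum_le (fun i => cmod (f i)) C -> cmod (sum f) <= C.
Proof.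
move=> fC; have := @sum_tail_le f fset0 C.
by rewrite big_seq_fset0 subr0; apply => //; exists C.
Qed.

End Summability.

Lemma cvg_finsum (R : realType) (I : Type) (T : Type) (F : set_system T)
    {FF : Filter F} (s : seq I) (f : T -> I -> cplx R) (l : I -> cplx R) :
  (forall i, (f^~ i) @ F --> l i) ->
  (fun t => \sum_(i <- s) f t i) @ F --> \sum_(i <- s) l i.
Proof.
move=> h; elim: s => [|i s IH].
  rewrite big_nil; under eq_fun do rewrite big_nil.
  exact: cvg_cst.
rewrite big_cons; under eq_fun do rewrite big_cons.
exact: cvg_cplxD (h i) IH.
Qed.

(** Dominated convergence for sums, along any filter: a finite set carries the
    dominating sum up to [e / 3], and finite sums commute with limits.  Fubini,
    termwise differentiation and the continuity of convolution powers are all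
    instances, for different filters. *)
Lemma tannery (R : realType) (I : choiceType) (T : Type) (F : set_system T)
    {FF : Filter F} (f : T -> I -> cplx R) (l : I -> cplx R) (M : I -> R) C :
  sum_le M C ->
  (\forall t \near F, forall i, cmod (f t i) <= M i) ->
  (forall i, cmod (l i) <= M i) ->
  (forall i, (f^~ i) @ F --> l i) ->
  (fun t => sum (f t)) @ F --> sum l.
Proof.
move=> MC fM lM fl; apply/cvg_cmodP => e e0.
have M0 i : 0 <= M i by apply: le_trans (lM i); apply: cmod_ge0.
have e3 : 0 < e / 3 by rewrite divr_gt0.
have [J0 hJ] := sum_le_tail M0 MC e3.
have tail (g : I -> cplx R) : (forall i, cmod (g i) <= M i) ->
    cmod (sum g - \sum_(i <- J0) g i) <= e / 3.
  move=> gM; apply: sum_tail_le; first exact: abs_summable_le gM MC.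
  by move=> K dK; apply: le_trans (hJ K dK); apply: ler_sum.
have /cvg_cmodP/(_ _ e3) hfin :
    (fun t => \sum_(i <- J0) f t i) @ F --> \sum_(i <- J0) l i.
  exact: cvg_finsum.
apply: filterS2 fM hfin => t ht1 ht2.
have h1 := tail _ ht1; have h2 := tail _ lM.
set A := \sum_(i <- J0) f t i in h1 ht2; set B := \sum_(i <- J0) l i in h2 ht2.
have -> : sum l - sum (f t) = (sum l - B) + ((B - A) + (A - sum (f t))).
  by ring.
apply: le_lt_trans (cmodD _ _) _.
have := cmodD (B - A) (A - sum (f t)); rewrite [cmod (A - _)]cmodBC; lra.
Qed.

(** * Reindexing and exchange of sums *)

Section SumMore.
Variables (R : realType).

Lemma cmod_sum_maj (I : choiceType) (f F : I -> cplx R) :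
  (forall i, cmod (f i) <= complex.Re (F i)) -> abs_summable F ->
  cmod (sum f) <= complex.Re (sum F).
Proof.
move=> fF hF; have hf : abs_summable f.
  have [C hC] := hF; apply: (abs_summable_le _ hC) => i.
  by apply: le_trans (fF i) _; apply: le_trans (ler_norm _) (Re_le_cmod _).
apply/ler_addgt0Pr => e e0; have e2 : 0 < e / 2 by rewrite divr_gt0.
have /cvg_cmodP/(_ _ e2) h1 := abs_summable_cvg hf.
have /cvg_cmodP/(_ _ e2) h2 := abs_summable_cvg hF.
have [J [h3 h4]] := filter_ex (filterI h1 h2).
rewrite -[sum f](subrK (\sum_(i <- J) f i)); apply: le_trans (cmodD _ _) _.
have : cmod (\sum_(i <- J) f i) <= complex.Re (\sum_(i <- J) F i).
  by rewrite Re_sum; apply: le_trans (cmod_sum _ _ _) _; apply: ler_sum.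
have := le_lt_trans (Re_le_cmod _) h4.
by rewrite ReD ReN ltr_norml => /andP[]; move: h3; lra.
Qed.

Lemma sum_le_reindex (I I' : choiceType) (s : I -> I') (M : I' -> R) C :
  injective s -> sum_le M C -> sum_le (fun i => M (s i)) C.
Proof.
move=> sI hM J; have := hM (s @` J)%fset.
by rewrite big_imfset //= => i j _ _; apply: sI.
Qed.

Lemma sum_reindex (I I' : choiceType) (s : I -> I') (s' : I' -> I)
    (f : I' -> cplx R) :
  cancel s s' -> cancel s' s -> abs_summable f ->
  sum (fun i => f (s i)) = sum f.
Proof.
move=> sK s'K hf; apply: sum_eq_lim.
have h : (fun J : {fset I} => (s @` J)%fset) @ totally --> (@totally I').
  move=> A [J _ hJ]; exists (s' @` J)%fset => // K /= /fsubsetP JK.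
  apply: hJ => /=; apply/fsubsetP => i iJ.
  by apply/imfsetP; exists (s' i) => //=; apply: JK; apply: in_imfset.
apply: cvg_trans (cvg_comp _ _ h (abs_summable_cvg hf)).
apply: near_eq_cvg; apply: nearW => J /=.
by rewrite big_imfset //= => i j _ _; apply: (can_inj sK).
Qed.

Section Swap.
Variables (I I' : choiceType) (f : I -> I' -> cplx R) (M : I -> R) (C : R).
Hypothesis fM : forall i, sum_le (fun j => cmod (f i j)) (M i).
Hypothesis MC : sum_le M C.

Let f_le i j : cmod (f i j) <= M i.
Proof. exact: (@sum_le_ub _ _ _ _ j (fun j => cmod_ge0 (f i j)) (fM i)). Qed.

Lemma abs_summable_row i : abs_summable (f i).
Proof. by exists (M i). Qed.

Lemma abs_summable_col j : abs_summable (f^~ j).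
Proof. exact: (abs_summable_le (f_le^~ j) MC). Qed.

Lemma sum_finsum (I0 : choiceType) (s : seq I0) (g : I -> I0 -> cplx R) :
  (forall j, abs_summable (g^~ j)) ->
  abs_summable (fun i => \sum_(j <- s) g i j) /\
  sum (fun i => \sum_(j <- s) g i j) = \sum_(j <- s) sum (g^~ j).
Proof.
move=> hg; elim: s => [|j s [IH1 IH2]].
  have -> : (fun i => \sum_(j <- [::]) g i j) = fun=> 0.
    by apply/funext => i; rewrite big_nil.
  rewrite big_nil; split; last exact: sum0.
  by exists 0 => J; rewrite big1 // => i _; rewrite cmod0.
have -> : (fun i => \sum_(j <- j :: s) g i j) =
    (fun i => g i j + \sum_(j <- s) g i j).
  by apply/funext => i; rewrite big_cons.
rewrite big_cons -IH2 -sumD //; split => //; exact: abs_summableD.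
Qed.

(** Dominated convergence along the finite subsets of the second index set:
    for a finite subset the exchange is linearity of the sum. *)
Lemma sum_swap : sum (fun i => sum (f i)) = sum (fun j => sum (f^~ j)).
Proof.
apply/esym; apply: sum_eq_lim.
have h : (fun B : {fset I'} => sum (fun i => \sum_(j <- B) f i j)) @ totally
    --> sum (fun i => sum (f i)).
  apply: (tannery MC).
  - apply: nearW => B i; apply: le_trans (cmod_sum _ _ _) _; exact: fM.
  - by move=> i; apply: cmod_sum_le.
  - by move=> i; apply: abs_summable_cvg; apply: abs_summable_row.
apply: cvg_trans h; apply: near_eq_cvg; apply: nearW => B.
by have [_ ->] := sum_finsum B abs_summable_col.
Qed.

(** The l^1 bound that accompanies the exchange; it yields all norm estimates
    for Cauchy products. *)
Lemma sum_le_col_sum : sum_le (fun j => cmod (sum (f^~ j))) C.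
Proof.
move=> B.
have hc j : abs_summable (fun i => (cmod (f i j))%:C%C : cplx R).
  apply: (abs_summable_le _ MC) => i; rewrite cmod_real ger0_norm ?cmod_ge0 //.
have [_ h] := sum_finsum B hc.
apply: (@le_trans _ _ (complex.Re (\sum_(j <- B)
    sum (fun i => (cmod (f i j))%:C%C : cplx R)))).
  by rewrite Re_sum; apply: ler_sum => j _; apply: cmod_sum_maj.
rewrite -h; apply: le_trans (ler_norm _) _; apply: le_trans (Re_le_cmod _) _.
apply: cmod_sum_le; apply: sum_le_mono MC => i.
apply: le_trans (cmod_sum _ _ _) _; apply: le_trans (fM i B).
by apply: ler_sum => j _; rewrite cmod_real ger0_norm ?cmod_ge0.
Qed.

End Swap.
End SumMore.

(** * The Cauchy product *)

Section Convolution.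
Variables (R : realType) (nu : nat).
Local Notation Z := 'rV[int]_nu.
Implicit Types (a b x y z : Z -> cplx R) (n m k : Z).

Lemma sum_le_shift (M : Z -> R) C m :
  sum_le M C -> sum_le (fun n => M (n - m)) C.
Proof. by apply: sum_le_reindex => i j /addIr. Qed.

Lemma abs_summable_conv_term a b n : abs_summable a -> abs_summable b ->
  abs_summable (fun m => a m * b (n - m)).
Proof.
move=> [C hC] [D hD].
have bD m : cmod (b m) <= D by apply: (@sum_le_ub _ _ _ _ m (fun j => cmod_ge0 (b j)) hD).
have D0 := sum_le_ge0 hD.
apply: (abs_summable_le _ (sum_leZ D0 hC)) => m.
by rewrite cmodM mulrC ler_wpM2r ?cmod_ge0.
Qed.

(** A submultiplicative weight makes the weighted l^1 space a Banach algebra. *)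
Lemma cauchy_prod_wle (w : Z -> R) a b C D :
  (forall n, 0 <= w n) -> (forall n m, w n <= w m * w (n - m)) ->
  sum_le (fun n => w n * cmod (a n)) C -> sum_le (fun n => w n * cmod (b n)) D ->
  abs_summable a -> abs_summable b ->
  sum_le (fun n => w n * cmod (cauchy_prod a b n)) (C * D).
Proof.
move=> w0 wM hC hD ha hb.
have C0 := sum_le_ge0 hC; have D0 := sum_le_ge0 hD.
have h m : sum_le (fun n => cmod ((w n)%:C%C * (a m * b (n - m)) : cplx R))
    (D * (w m * cmod (a m))).
  have h1 := sum_le_shift m hD.
  rewrite mulrC; apply: sum_le_mono (sum_leZ _ h1) => [n|]; last first.
    by rewrite mulr_ge0 ?cmod_ge0.
  rewrite !cmodM cmod_real ger0_norm // [leRHS]mulrACA.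
  by rewrite ler_wpM2r // mulr_ge0 ?cmod_ge0.
have := sum_le_col_sum h (sum_leZ D0 hC).
rewrite mulrC; apply: sum_le_mono => n.
rewrite sumZ; last exact: abs_summable_conv_term.
by rewrite cmodM cmod_real ger0_norm.
Qed.

Lemma cauchy_prod_le a b C D :
  sum_le (fun n => cmod (a n)) C -> sum_le (fun n => cmod (b n)) D ->
  sum_le (fun n => cmod (cauchy_prod a b n)) (C * D).
Proof.
move=> hC hD; have := @cauchy_prod_wle (fun=> 1) a b C D.
under [X in sum_le X C]eq_fun do rewrite mul1r.
under [X in sum_le X D]eq_fun do rewrite mul1r.
under [X in sum_le X (C * D)]eq_fun do rewrite mul1r.
by apply=> //; [move=> ? ?; rewrite mulr1|exists C|exists D].
Qed.

Lemma abs_summable_conv a b : abs_summable a -> abs_summable b ->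
  abs_summable (cauchy_prod a b).
Proof. by move=> [C hC] [D hD]; exists (C * D); apply: cauchy_prod_le. Qed.

Lemma cauchy_prodBl a a' b : abs_summable a -> abs_summable a' ->
  abs_summable b -> forall n,
  cauchy_prod (fun m => a m - a' m) b n = cauchy_prod a b n - cauchy_prod a' b n.
Proof.
move=> ha ha' hb n; rewrite /cauchy_prod.
under eq_sum do rewrite mulrBl.
by rewrite sumB //; apply: abs_summable_conv_term.
Qed.

Lemma cauchy_prodBr a b b' : abs_summable a -> abs_summable b ->
  abs_summable b' -> forall n,
  cauchy_prod a (fun m => b m - b' m) n = cauchy_prod a b n - cauchy_prod a b' n.
Proof.
move=> ha hb hb' n; rewrite /cauchy_prod.
under eq_sum do rewrite mulrBr.
by rewrite sumB //; apply: abs_summable_conv_term.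
Qed.

Lemma cauchy_prodZr (k : cplx R) a b : abs_summable a -> abs_summable b -> forall n,
  cauchy_prod a (fun m => k * b m) n = k * cauchy_prod a b n.
Proof.
move=> ha hb n; rewrite /cauchy_prod.
by under eq_sum do rewrite mulrCA; rewrite sumZ //; apply: abs_summable_conv_term.
Qed.

Lemma cauchy_prodC a b : abs_summable a -> abs_summable b ->
  cauchy_prod a b =1 cauchy_prod b a.
Proof.
move=> ha hb n; rewrite /cauchy_prod.
rewrite -(@sum_reindex _ _ _ (fun m => n - m) (fun m => n - m)).
- by apply: eq_sum => m; rewrite subKr mulrC.
- by move=> m; rewrite subKr.
- by move=> m; rewrite subKr.
- exact: abs_summable_conv_term.
Qed.

(** Commutativity and associativity combined into an identity that is a mere
    exchange of two sums; it is the form in which the Leibniz rule for powers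
    uses them. *)
Lemma cauchy_prod_leftC x y z : abs_summable x -> abs_summable y ->
  abs_summable z ->
  cauchy_prod x (cauchy_prod y z) =1 cauchy_prod y (cauchy_prod x z).
Proof.
move=> [X hX] [Y hY] [D hD] n; rewrite /cauchy_prod.
have hz m : cmod (z m) <= D by apply: (@sum_le_ub _ _ _ _ m (fun j => cmod_ge0 (z j)) hD).
have D0 := sum_le_ge0 hD; have Y0 := sum_le_ge0 hY.
have sx : abs_summable x by exists X.
have sy : abs_summable y by exists Y.
have sz : abs_summable z by exists D.
transitivity (sum (fun m => sum (fun k => x m * (y k * z (n - m - k))))).
  by apply: eq_sum => m; rewrite sumZ //; apply: abs_summable_conv_term.
rewrite (@sum_swap _ _ _ _ (fun m => (Y * D) * cmod (x m)) ((Y * D) * X)).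
- apply: eq_sum => k; rewrite -sumZ; last exact: abs_summable_conv_term.
  by apply: eq_sum => m; rewrite mulrCA addrAC.
- move=> m; have := sum_leZ (mulr_ge0 D0 (cmod_ge0 (x m))) hY.
  have -> : Y * D * cmod (x m) = D * cmod (x m) * Y by ring.
  apply: sum_le_mono => k; rewrite !cmodM.
  have -> : D * cmod (x m) * cmod (y k) = cmod (x m) * (cmod (y k) * D) by ring.
  by rewrite !ler_wpM2l ?cmod_ge0.
- by apply: sum_leZ hX; rewrite mulr_ge0.
Qed.

End Convolution.

(** * Quasi-periodic series and their coefficients *)

Section Exponential.
Variable R : realType.
Implicit Types s t : R.

Lemma expiD s t : expi (s + t) = expi s * expi t.
Proof.
apply/eqP; rewrite eq_complex /= cosD sinD eqxx /=.
by apply/eqP; ring.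
Qed.

Lemma expi0 : expi 0 = 1 :> cplx R.
Proof. by rewrite /expi cos0 sin0. Qed.

Lemma cmod_expi t : cmod (expi t) = 1.
Proof. by rewrite /expi /ComplexField.Normc.normc cos2Dsin2 sqrtr1. Qed.

Lemma expipi : expi pi = -1 :> cplx R.
Proof. by rewrite /expi cospi sinpi; apply/eqP; rewrite eq_complex /= oppr0 !eqxx. Qed.

End Exponential.

Section QPSeries.
Variables (R : realType) (nu : nat) (omega : 'rV[R]_nu).
Local Notation Z := 'rV[int]_nu.
Local Notation freq := (freq omega).
Local Notation dx := (dx_coef omega).
Implicit Types (a b : Z -> cplx R) (n m k : Z).

Lemma freqD n m : freq (n + m) = freq n + freq m.
Proof.
by rewrite /Defs.freq -big_split; apply: eq_bigr => j _; rewrite mxE rmorphD mulrDl.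
Qed.

Lemma freqN n : freq (- n) = - freq n.
Proof.
by rewrite /Defs.freq -sumrN; apply: eq_bigr => j _; rewrite mxE rmorphN mulNr.
Qed.

Lemma freqB n m : freq (n - m) = freq n - freq m.
Proof. by rewrite freqD freqN. Qed.

Lemma dx_cauchy_prod a b : abs_summable a -> abs_summable b ->
  abs_summable (dx a) -> abs_summable (dx b) -> forall n,
  dx (cauchy_prod a b) n = cauchy_prod (dx a) b n + cauchy_prod a (dx b) n.
Proof.
move=> ha hb hda hdb n; rewrite {1}/dx_coef /cauchy_prod.
rewrite -sumD; try exact: abs_summable_conv_term.
rewrite -sumZ; last exact: abs_summable_conv_term.
apply: eq_sum => m; rewrite /dx_coef.
have -> : freq n = freq (n - m) + freq m by rewrite -freqD subrK.
rewrite rmorphD /=; move: (_%:C%C) (_%:C%C) => u v; ring.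
Qed.

(** The power of exponent [j.+1] for the Cauchy product; starting the iteration
    at [a] avoids introducing the unit of the convolution algebra. *)
Definition conv_pow a (j : nat) := iter j (cauchy_prod a) a.

Lemma abs_summable_iter a b j : abs_summable a -> abs_summable b ->
  abs_summable (iter j (cauchy_prod a) b).
Proof. by move=> ha hb; elim: j => //= j; apply: abs_summable_conv. Qed.

(** The Leibniz rule d (a^(j+1)) = (j+1) a^j (d a). *)
Lemma dx_conv_pow a j : abs_summable a -> abs_summable (dx a) ->
  dx (conv_pow a j) = fun n => j.+1%:R * iter j (cauchy_prod a) (dx a) n.
Proof.
move=> ha hda; elim: j => [|j IH]; first by apply/funext => n; rewrite mul1r.
have hit := abs_summable_iter j ha hda.
have comm : cauchy_prod (dx a) (conv_pow a j) =
    iter j.+1 (cauchy_prod a) (dx a).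
  elim: j {IH hit} => [|j IH]; first by apply/funext; exact: cauchy_prodC.
  rewrite [RHS]iterS -IH; apply/funext => n.
  by apply: cauchy_prod_leftC => //; exact: abs_summable_iter.
apply/funext => n; rewrite [LHS]dx_cauchy_prod //;
  [|exact: abs_summable_iter|by rewrite IH; exact: abs_summableZ].
by rewrite comm IH cauchy_prodZr //= [in RHS]mulrS mulrDl mul1r.
Qed.

(** On coefficients, u^(p-1) u_x = (u^p)_x / p.  The outer derivative can then be
    absorbed by the inverse of 1 - d^2, whatever the size of [omega]. *)
Lemma nonlin_coefE (p : nat) a : (0 < p)%N -> abs_summable a ->
  abs_summable (dx a) -> forall n,
  nonlin_coef omega p a n = p%:R^-1 * dx (conv_pow a p.-1) n.
Proof.
case: p => // p _ ha hda n; rewrite dx_conv_pow //.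
by rewrite mulrA mulVf ?mul1r // pnatr_eq0.
Qed.

Lemma cmod_qp_term a x n : cmod (a n * expi (freq n * x)) = cmod (a n).
Proof. by rewrite cmodM cmod_expi mulr1. Qed.

Lemma abs_summable_qp a x : abs_summable a ->
  abs_summable (fun n => a n * expi (freq n * x)).
Proof.
by move=> [C hC]; exists C; apply: sum_le_mono hC => n; rewrite cmod_qp_term.
Qed.

(** Exchange the two sums; the inner one is then a translate of the sum of
    [b]. *)
Lemma sum_cauchy_prod a b : abs_summable a -> abs_summable b ->
  sum (cauchy_prod a b) = sum a * sum b.
Proof.
move=> ha hb; have [[C hC] [D hD]] := (ha, hb); have D0 := sum_le_ge0 hD.
rewrite /cauchy_prod.
rewrite -(@sum_swap _ _ _ (fun m n => a m * b (n - m))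
  (fun m => D * cmod (a m)) (D * C)).
- rewrite mulrC -sumZ //; apply: eq_sum => m.
  rewrite sumZ; last first.
    by exists D; exact: (sum_le_shift m hD).
  rewrite mulrC; congr (_ * _).
  by apply: (@sum_reindex _ _ _ (fun n => n - m) (fun n => n + m)) => // n;
    rewrite ?subrK ?addrK.
- move=> m; have := sum_leZ (cmod_ge0 (a m)) (sum_le_shift m hD).
  by rewrite mulrC; apply: sum_le_mono => n; rewrite cmodM.
- exact: sum_leZ.
Qed.

Lemma qp_sum_cauchy_prod a b x : abs_summable a -> abs_summable b ->
  qp_sum omega (cauchy_prod a b) x = qp_sum omega a x * qp_sum omega b x.
Proof.
move=> ha hb; rewrite /qp_sum -sum_cauchy_prod; try exact: abs_summable_qp.
apply: eq_sum => n; rewrite /cauchy_prod mulrC -sumZ; last first.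
  exact: abs_summable_conv_term.
apply: eq_sum => m; 
have -> : freq n = freq (n - m) + freq m by rewrite -freqD subrK.
rewrite mulrDl expiD; ring.
Qed.

Lemma qp_sum_iter a b j x : abs_summable a -> abs_summable b ->
  qp_sum omega (iter j (cauchy_prod a) b) x =
  qp_sum omega a x ^+ j * qp_sum omega b x.
Proof.
move=> ha hb; elim: j => [|j IH]; first by rewrite mul1r.
by rewrite /= qp_sum_cauchy_prod ?IH ?exprS ?mulrA //; exact: abs_summable_iter.
Qed.

(** The operator f |-> (f x + e^(- i <m> h) f (x + h)) / 2 fixes the [m]-th
    coefficient and increases no other in modulus, as it multiplies the [k]-th
    one by (1 + e^(i <k - m> h)) / 2; with h = pi / <n - m> the [n]-th one is
    killed.  Non-resonance makes this choice of h possible. *)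
Lemma qp_sum_kill a m (s : seq Z) : nonresonant omega -> abs_summable a ->
  (forall x, qp_sum omega a x = 0) -> m \notin s ->
  exists b, [/\ b m = a m, forall n, cmod (b n) <= cmod (a n),
    forall n, n \in s -> b n = 0 & forall x, qp_sum omega b x = 0].
Proof.
move=> nr ha a0; elim: s => [|n s IH]; first by exists a.
rewrite inE negb_or => /andP[mn /IH[b [bm ba bs b0]]].
have nm : freq (n - m) != 0.
  by apply: contra_neq mn => /nr/eqP; rewrite subr_eq0 => /eqP ->.
(* Then e^(i <n - m> h) = -1. *)
pose h := pi / freq (n - m).
have hb : abs_summable b.
  by have [C hC] := ha; apply: (abs_summable_le ba hC).
exists (fun k => 2^-1 * (b k + b k * expi (freq (k - m) * h))).
have two : cmod (2^-1 : cplx R) = 2^-1 by rewrite cmodV cmod_nat.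
split.
- rewrite subrr -(subrr m) freqB subrr mul0r expi0 mulr1 bm.
  by rewrite -[a m + a m]mulr2n -[a m *+ 2]mulr_natl mulrA mulVf ?mul1r // pnatr_eq0.
- move=> k; rewrite cmodM two; apply: le_trans (ba k).
  have := cmodD (b k) (b k * expi (freq (k - m) * h)).
  by rewrite cmodM cmod_expi mulr1; lra.
- move=> k; rewrite inE => /orP[/eqP ->|/bs ->]; last first.
    by rewrite mul0r addr0 mulr0.
  by rewrite /h mulrCA mulfV // mulr1 expipi mulrN1 subrr mulr0.
- move=> x; rewrite /qp_sum.
  transitivity (2^-1 * (qp_sum omega b x +
      expi (- freq m * h) * qp_sum omega b (x + h))); last first.
    by rewrite !b0 mulr0 addr0 mulr0.
  rewrite /qp_sum -sumZ; last exact: abs_summable_qp.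
  rewrite -sumD; [|exact: abs_summable_qp|]; last first.
    by apply: abs_summableZ; exact: abs_summable_qp.
  rewrite -sumZ; last first.
    apply: abs_summableD; first exact: abs_summable_qp.
    by apply: abs_summableZ; exact: abs_summable_qp.
  apply: eq_sum => k; rewrite -mulrA; congr (_ * _).
  have -> : expi (freq (k - m) * h) = expi (- freq m * h) * expi (freq k * h).
    by rewrite -expiD freqB; congr expi; ring.
  have -> : expi (freq k * (x + h)) = expi (freq k * x) * expi (freq k * h).
    by rewrite -expiD; congr expi; ring.
  ring.
Qed.

(** Kill all coefficients but the [m]-th on a finite set that carries the l^1
    norm of [a] up to [e]: the value at 0 of the new series, which is zero,
    differs from [a m] by at most [e]. *)
Lemma qp_sum_eq0 a : nonresonant omega -> abs_summable a ->
  (forall x, qp_sum omega a x = 0) -> forall m, a m = 0.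
Proof.
move=> nr ha a0 m; apply: cmod_eq0; apply/eqP; rewrite eq_le cmod_ge0 andbT.
apply/ler_addgt0Pr => e e0; rewrite add0r.
have [C hC] := ha.
have [J0 hJ] := sum_le_tail (fun i => cmod_ge0 (a i)) hC e0.
have [|b [bm ba bs b0]] := @qp_sum_kill a m (J0 `\ m)%fset nr ha a0.
  by rewrite !inE eqxx.
have hb : abs_summable b by apply: (abs_summable_le ba hC).
have sb0 : sum b = 0.
  rewrite -[RHS](b0 0); apply: eq_sum => n.
  by rewrite mulr0 expi0 mulr1.
have := @sum_tail_le _ _ b (m |` J0)%fset e hb.
rewrite sb0 sub0r cmodN => h; rewrite -bm.
have -> : b m = \sum_(i <- (m |` J0)%fset) b i.
  rewrite (big_fsetD1 m) ?fset1U1 //= -[LHS]addr0; congr (_ + _).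
  rewrite big_seq big1 // => i; rewrite !inE => /andP[im /orP[/eqP e'|iJ]].
    by rewrite e' eqxx in im.
  by apply: bs; rewrite !inE im.
apply: h => K dK; apply: le_trans (hJ K _).
  by apply: ler_sum.
by apply: fdisjointWl dK; exact: fsubsetU1.
Qed.

End QPSeries.

(** * Differentiation on a subset of the line *)

Section Calculus.
Variable R : realType.
Implicit Types (D : set R) (f g df dg : R -> cplx R) (s t : R).

Lemma near_punctured D t (P : set R) :
  (\forall s \near within D t^', P s) <->
  exists2 d, 0 < d & forall s, `|t - s| < d -> s != t -> D s -> P s.
Proof.
split=> [/nbhs_ballP[d d0 h]|[d d0 h]].
  by exists d => // s hs st Ds; exact: (h s hs st Ds).
by apply/nbhs_ballP; exists d => // s hs st Ds; exact: (h s hs st Ds).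
Qed.

Lemma cvg_deriv_id D t : (fun s => (s - t)%:C%C : cplx R) @ within D t^' --> (0 : cplx R).
Proof.
apply/cvg_cmodP => e e0; apply/near_punctured; exists e => // s hs _ _.
by rewrite sub0r cmodN cmod_real distrC.
Qed.

Lemma deriv_cvg D f df t : deriv_on D f df -> D t -> f @ within D t^' --> f t.
Proof.
move=> /[apply] h.
have h1 : (fun s => (f s - f t) / (s - t)%:C%C * (s - t)%:C%C + f t)
    @ within D t^' --> df t * 0 + f t.
  by apply: cvg_cplxD (cvg_cst _); apply: cvg_cplxM h (cvg_deriv_id D t).
rewrite mulr0 add0r in h1.
apply: cvg_trans h1; apply: near_eq_cvg; apply/near_punctured.
exists 1 => // s _ st _; rewrite divfK ?subrK //.
by rewrite eq_complex /= subr_eq0 (negbTE st).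
Qed.

Lemma within_continuousP D f :
  {within D, continuous f} <-> forall t, D t -> f @ within D (nbhs t) --> f t.
Proof. exact: subspace_continuousP. Qed.

Lemma deriv_continuous D f df : deriv_on D f df -> {within D, continuous f}.
Proof.
move=> h; apply/within_continuousP => t Dt.
have /cvg_cmodP h1 := deriv_cvg h Dt; apply/cvg_cmodP => e e0.
have /near_punctured[d d0 hd] := h1 e e0.
apply/nbhs_ballP; exists d => // s hs Ds.
by have [->|st] := eqVneq s t; [rewrite subrr cmod0|exact: hd].
Qed.

Lemma deriv_onW D D' f df : D' `<=` D -> deriv_on D f df -> deriv_on D' f df.
Proof.
move=> DD h t D't; have /cvg_cmodP h1 := h t (DD _ D't).
apply/cvg_cmodP => e e0; have /near_punctured[d d0 hd] := h1 e e0.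
by apply/near_punctured; exists d => // s hs st D's; apply: hd => //; apply: DD.
Qed.

Lemma eq_deriv_on D f g df dg : (forall t, D t -> f t = g t) ->
  (forall t, D t -> df t = dg t) -> deriv_on D f df -> deriv_on D g dg.
Proof.
move=> fg dfg h t Dt; rewrite -dfg //; apply: cvg_trans (h t Dt).
apply: near_eq_cvg; apply/near_punctured; exists 1 => // s _ _ Ds.
by rewrite !fg.
Qed.

Lemma deriv_on_cst D (k : cplx R) : deriv_on D (fun=> k) (fun=> 0).
Proof.
by move=> t _; under eq_fun do rewrite subrr mul0r; exact: cvg_cst.
Qed.

Lemma deriv_onD D f g df dg : deriv_on D f df -> deriv_on D g dg ->
  deriv_on D (fun t => f t + g t) (fun t => df t + dg t).
Proof.
move=> hf hg t Dt; apply: cvg_trans (cvg_cplxD (hf t Dt) (hg t Dt)).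
apply: near_eq_cvg; apply: nearW => s; rewrite -mulrDl; congr (_ / _); ring.
Qed.

Lemma deriv_onM D f g df dg : deriv_on D f df -> deriv_on D g dg ->
  deriv_on D (fun t => f t * g t) (fun t => df t * g t + f t * dg t).
Proof.
move=> hf hg t Dt.
apply: cvg_trans (cvg_cplxD (cvg_cplxM (hf t Dt) (deriv_cvg hg Dt))
  (cvg_cplxM (cvg_cst (f t)) (hg t Dt))).
apply: near_eq_cvg; apply: nearW => s; ring.
Qed.

Lemma deriv_onZ D (k : cplx R) f df : deriv_on D f df ->
  deriv_on D (fun t => k * f t) (fun t => k * df t).
Proof.
move=> h; apply: (eq_deriv_on _ _ (deriv_onM (deriv_on_cst k) h)) => // t _.
by rewrite mul0r add0r.
Qed.

Arguments deriv_onZ {D} k {f df} _.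

Lemma deriv_onB D f g df dg : deriv_on D f df -> deriv_on D g dg ->
  deriv_on D (fun t => f t - g t) (fun t => df t - dg t).
Proof.
move=> hf hg.
by apply: (eq_deriv_on _ _ (deriv_onD hf (deriv_onZ (-1) hg))) => t _;
  rewrite mulN1r.
Qed.

Lemma deriv_on_finsum D (I : Type) (s : seq I) (f df : I -> R -> cplx R) :
  (forall i, deriv_on D (f i) (df i)) ->
  deriv_on D (fun t => \sum_(i <- s) f i t) (fun t => \sum_(i <- s) df i t).
Proof.
move=> h; elim: s => [|i s IH].
  by apply: (eq_deriv_on _ _ (deriv_on_cst 0)) => t _; rewrite big_nil.
by apply: (eq_deriv_on _ _ (deriv_onD (h i) IH)) => t _; rewrite big_cons.
Qed.

Lemma is_derive_deriv_on D (phi dphi : R -> R) :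
  (forall t, D t -> is_derive t 1 phi (dphi t)) ->
  deriv_on D (fun t => (phi t)%:C%C) (fun t => (dphi t)%:C%C).
Proof.
move=> h t Dt; have [hd he] := h t Dt.
have : h0^-1 *: ((phi \o shift t) (h0 *: 1) - phi t) @[h0 --> 0^'] --> dphi t.
  by rewrite -he; exact: hd.
move=> /cvgrPdist_lt h1; apply/cvg_cmodP => e e0.
have /nbhs_ballP[d d0 hd'] := h1 e e0.
apply/near_punctured; exists d => // s hs st _.
have /= := hd' (s - t); rewrite /ball /= sub0r normrN distrC => /(_ hs).
rewrite subr_eq0 => /(_ st).
have -> : ((phi s)%:C%C - (phi t)%:C%C) / (s - t)%:C%C =
    ((s - t)^-1 * (phi s - phi t))%:C%C :> cplx R.
  by rewrite mulrC rC_mul (rC_sub (phi s)) rC_inv.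
by rewrite /GRing.scale /= mulr1 subrK -rmorphB cmod_real.
Qed.

Lemma deriv_on_expi D (k : R) :
  deriv_on D (fun t => expi (k * t)) (fun t => 'i%C * k%:C%C * expi (k * t)).
Proof.
have dlin t : is_derive t 1 (fun s => k * s) k.
  by have := is_deriveZ k (is_derive_id t (1 : R)); rewrite /GRing.scale /= mulr1.
have hc : deriv_on D (fun t => (cos (k * t))%:C%C)
    (fun t => (- sin (k * t) * k)%:C%C).
  exact: is_derive_deriv_on.
have hs : deriv_on D (fun t => (sin (k * t))%:C%C)
    (fun t => (cos (k * t) * k)%:C%C).
  exact: is_derive_deriv_on.
apply: (eq_deriv_on _ _ (deriv_onD hc (deriv_onZ 'i%C hs))) => t _.
  by rewrite /expi [RHS]complexE.
apply/eqP; rewrite eq_complex /=; apply/andP; split; apply/eqP; ring.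
Qed.

Section MeanValue.
Variables (D : set R) (Dint : is_interval D).

(** The real part is taken because the mean value theorem is a statement about
    ordered values; the theorem itself is applied between [s] and [t], where
    the relative derivative is the ordinary one. *)
Lemma deriv_on_Re_nincr f df s t : deriv_on D f df ->
  (forall u, D u -> complex.Re (df u) <= 0) -> D s -> D t -> s <= t ->
  complex.Re (f t) <= complex.Re (f s).
Proof.
move=> hf hdf Ds Dt; rewrite le_eqVlt => /predU1P[->//|st].
pose phi u := complex.Re (f u).
have sub u : s <= u <= t -> D u.
  by move=> hu; apply: (Dint Ds Dt).
have hder u : u \in `]s, t[ -> is_derive u 1 phi (complex.Re (df u)).
  move=> hu; have Du : D u by apply: sub; rewrite !(itvP hu).
  have : h^-1 *: ((phi \o shift u) (h *: 1) - phi u) @[h --> 0^'] -->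
      complex.Re (df u).
    have /cvg_Re/cvgrPdist_lt h := hf u Du.
    apply/cvgrPdist_lt => e e0; have /near_punctured[d d0 hd] := h e e0.
    apply/nbhs_ballP; exists (Num.min d (Num.min (u - s) (t - u))).
      by rewrite /= !lt_min d0 !subr_gt0 !(itvP hu).
    move=> v; rewrite /ball /= sub0r normrN !lt_min => /andP[v1 /andP[v2 v3]] v0.
    have := hd (v + u); rewrite opprD addrCA subrr addr0 normrN => /(_ v1).
    rewrite -subr_eq0 addrK => /(_ v0) h'.
    have {h'} := h' _; rewrite /GRing.scale /= mulr1 => h'.
    have : D (v + u).
      by apply: sub; move: v2 v3; rewrite !ltr_norml; lra.
    by move=> /h'; rewrite mulrC -rC_inv Re_Cmul ReD ReN.
  move=> hc; apply: DeriveDef; first by apply/cvg_ex; exists (complex.Re (df u)).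
  by apply: cvg_lim hc; exact: norm_hausdorff.
have hcont : {within `[s, t], continuous phi}.
  have := deriv_continuous (deriv_onW (D' := `[s, t]) _ hf).
  move=> /(_ _)/within_continuousP h; apply/subspace_continuousP => u hu.
  apply: cvg_Re; apply: h => // v /=; rewrite in_itv /=; exact: sub.
have [c hc e] := MVT st hder hcont.
rewrite -subr_le0 e mulr_le0_ge0 ?subr_ge0 ?(ltW st) //.
by apply: hdf; apply: sub; rewrite !(itvP hc).
Qed.

(** Rotating [f] by the unit number that makes f t - f s positive reduces to the
    monotonicity of the real part, without loss in the constant. *)
Lemma deriv_on_lip f df (M : R) s t : deriv_on D f df ->
  (forall u, D u -> cmod (df u) <= M) -> D s -> D t ->
  cmod (f t - f s) <= M * `|t - s|.
Proof.
move=> hf hM; wlog st : s t / s <= t.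
  by move=> H Ds Dt; have /orP[/H|/H] := le_total s t;
    [apply|rewrite cmodBC distrC; apply].
move=> Ds Dt; set z := f t - f s; have [->|z0] := eqVneq z 0.
  by rewrite cmod0 mulr_ge0 // (le_trans _ (hM _ Ds)) ?cmod_ge0.
have cz : cmod z != 0 by apply: contra_neq z0 => /cmod_eq0.
pose k : cplx R := (cmod z)%:C%C / z.
have ck : cmod k = 1.
  by rewrite cmodM cmodV cmod_real ger0_norm ?cmod_ge0 // divff.
have kz : k * z = (cmod z)%:C%C by rewrite divfK.
have hid : deriv_on D (fun t => t%:C%C) (fun=> 1%:C%C).
  by apply: is_derive_deriv_on => u _; exact: is_derive_id.
have := deriv_on_Re_nincr (deriv_onB (deriv_onZ k hf) (deriv_onZ M%:C%C hid)) _ Ds Dt st.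
have h u : D u -> complex.Re (k * df u - M%:C%C * 1%:C%C) <= 0.
  move=> Du; rewrite ReD ReN -rmorphM /= mulr1 subr_le0.
  apply: le_trans (ler_norm _) _; apply: le_trans (Re_le_cmod _) _.
  by rewrite cmodM ck mul1r hM.
move=> /(_ h); rewrite !ReD !ReN -!rmorphM /=.
have : complex.Re (k * z) = cmod z by rewrite kz.
rewrite /z mulrBr ReD ReN ger0_norm ?subr_ge0 //; lra.
Qed.

(** Difference quotients of [f i] are dominated by [M i] thanks to the mean
    value inequality, so dominated convergence applies to them. *)
Lemma deriv_on_sum (I : choiceType) (f df : I -> R -> cplx R) (M : I -> R) C :
  (forall i, deriv_on D (f i) (df i)) -> sum_le M C ->
  (forall i t, D t -> cmod (df i t) <= M i) ->
  (forall t, D t -> abs_summable (f^~ t)) ->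
  deriv_on D (fun t => sum (f^~ t)) (fun t => sum (df^~ t)).
Proof.
move=> hf MC dfM fs t Dt.
have h : (fun s => sum (fun i => (f i s - f i t) / (s - t)%:C%C)) @ within D t^'
    --> sum (df^~ t).
  apply: (tannery MC).
  - apply/near_punctured; exists 1 => // s _ st Ds i.
    rewrite cmodM cmodV cmod_real ler_pdivrMr ?normr_gt0 ?subr_eq0 //.
    exact: deriv_on_lip (hf i) (dfM i) Dt Ds.
  - by move=> i; exact: dfM.
  - by move=> i; exact: hf.
apply: cvg_trans h; apply: near_eq_cvg; apply/near_punctured; exists 1 => //.
move=> s _ st Ds; under eq_sum do rewrite mulrC.
rewrite sumZ; last by apply: abs_summableB; exact: fs.
by rewrite sumB; [rewrite mulrC|exact: fs|exact: fs].
Qed.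

End MeanValue.

End Calculus.
Arguments deriv_onZ {R D} k {f df} _.

(** * Primitives of continuous functions *)

Section Primitive.
Variable R : realType.

Definition clamp (L x : R) : R := Num.max 0 (Num.min L x).

Lemma clamp_itv L x : 0 <= L -> 0 <= clamp L x <= L.
Proof.
by move=> L0; rewrite /clamp le_max lexx /= ge_max L0 ge_min lexx.
Qed.

Lemma clamp_id L x : 0 <= x <= L -> clamp L x = x.
Proof.
by case/andP=> h1 h2; rewrite /clamp (min_idPr h2) (max_idPr h1).
Qed.

Lemma clamp_lip L x y : `|clamp L x - clamp L y| <= `|x - y|.
Proof.
have h : x - y <= `|x - y| /\ y - x <= `|x - y|.
  by rewrite {2}(distrC x y) !ler_norm.
have hm : `|Num.min L x - Num.min L y| <= `|x - y|.
  by rewrite ler_norml; case: (leP L x) => ?; case: (leP L y) => ?; lra.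
apply: le_trans hm; rewrite /clamp; set a := Num.min L x; set b := Num.min L y.
have h' : a - b <= `|a - b| /\ b - a <= `|a - b|.
  by rewrite {2}(distrC a b) !ler_norm.
by rewrite ler_norml; case: (leP 0 a) => ?; case: (leP 0 b) => ?; lra.
Qed.

(** The integral starts at -1 so that 0 is an interior point, where the
    fundamental theorem gives a two-sided derivative. *)
Lemma real_primitive (g : R -> R) : continuous g ->
  exists F : R -> R, F 0 = 0 /\ forall x : R, 0 <= x -> is_derive x 1 F (g x).
Proof.
move=> cg.
pose F x := (\int[lebesgue_measure]_(t in `[(-1)%R, x]) g t)%R.
have dF (x : R) : 0 <= x -> is_derive x 1 F (g x).
  move=> x0; have xu : x < x + 1 by rewrite ltrDl.
  have ig : lebesgue_measure.-integrable `[(-1)%R, (x + 1)%R] (EFin \o g).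
    apply: continuous_compact_integrable; first exact: segment_compact.
    exact: continuous_subspaceT.
  have ax : -1 < x by lra.
  have [d e] := continuous_FTC1_closed xu ig ax (cg x).
  by apply: DeriveDef => //; rewrite -derive1E.
exists (fun x => F x - F 0); split; first by rewrite subrr.
move=> x x0; have := is_deriveB (dF x x0) (is_derive_cst (F 0) x 1).
by rewrite subr0.
Qed.

(** A continuous function on the interval is extended to the line by composition
    with the retraction [clamp], so that no endpoint needs a special
    treatment. *)
Lemma primitive_exists (L : R) (f : R -> cplx R) : 0 <= L ->
  {within `[0, L], continuous f} ->
  exists F, F 0 = 0 /\ deriv_on `[0, L] F f.
Proof.
move=> L0 /within_continuousP cf.
have cfc : forall x, (fun y => f (clamp L y)) @ x --> f (clamp L x).
  move=> x; apply/cvg_cmodP => e e0.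
  have cD : `[0, L]%classic (clamp L x) by rewrite /= in_itv /= clamp_itv.
  have /cvg_cmodP/(_ _ e0)/nbhs_ballP[d d0 hd] := cf _ cD.
  apply/nbhs_ballP; exists d => // y hy; apply: hd.
    by apply: le_lt_trans hy; exact: clamp_lip.
  by rewrite /= in_itv /= clamp_itv.
have [F [F0 dF]] := @real_primitive (fun y => complex.Re (f (clamp L y)))
  (fun x => cvg_Re (cfc x)).
have [G [G0 dG]] := @real_primitive (fun y => complex.Im (f (clamp L y)))
  (fun x => cvg_Im (cfc x)).
exists (fun x => (F x)%:C%C + 'i%C * (G x)%:C%C).
split; first by rewrite F0 G0 mulr0 addr0.
have h1 : deriv_on `[0, L] (fun x => (F x)%:C%C)
    (fun x => (complex.Re (f (clamp L x)))%:C%C).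
  by apply: is_derive_deriv_on => x; rewrite /= in_itv /= => /andP[/dF].
have h2 : deriv_on `[0, L] (fun x => (G x)%:C%C)
    (fun x => (complex.Im (f (clamp L x)))%:C%C).
  by apply: is_derive_deriv_on => x; rewrite /= in_itv /= => /andP[/dG].
apply: (eq_deriv_on _ _ (deriv_onD h1 (deriv_onZ 'i%C h2))) => // x.
by rewrite /= in_itv /= => /clamp_id ->; rewrite -complexE.
Qed.

End Primitive.

(** * Absolute and uniform convergence *)

Section UniformSums.
Variables (R : realType) (I : choiceType).

Lemma summable_absP (f : I -> cplx R) :
  esum.summable setT (fun n => (cmod (f n))%:E) <-> abs_summable f.
Proof.
rewrite /esum.summable; split=> [h|[C hC]].
  have h0 : (0 <= \esum_(x in setT) `|(cmod (f x))%:E|)%E.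
    by apply: esum_ge0 => x _; exact: abse_ge0.
  exists (fine (\esum_(x in setT) `|(cmod (f x))%:E|)%E) => J.
  rewrite -lee_fin fineK; last by rewrite ge0_fin_numE.
  apply: esum_ge; exists [set` J].
    by split=> //; exact: finite_fset.
  rewrite -fsbig_seq ?fset_uniq // -sumEFin le_eqVlt; apply/orP; left.
  by apply/eqP; apply: eq_bigr => i _; rewrite /= ger0_norm ?cmod_ge0.
apply: (@le_lt_trans _ _ C%:E); last exact: ltry.
apply: ge_ereal_sup => _ [X [Xfin _] <-].
rewrite fsbig_finite //= (eq_bigr (fun i => (cmod (f i))%:E)); last first.
  by move=> i _; rewrite /= ger0_norm ?cmod_ge0.
by rewrite sumEFin lee_fin.
Qed.

Lemma uniform_cmodP (T : choiceType) (U : Type) (F : set_system U)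
    {FF : Filter F} (D : set T) (f : U -> T -> cplx R) (s : T -> cplx R) :
  {uniform D, f @ F --> s} <->
  forall e : R, 0 < e ->
    \forall u \near F, forall z, D z -> cmod (s z - f u z) < e.
Proof.
split=> [h e e0|h P /uniform_nbhs[E [entE EP]]].
  apply: (h [set g | forall z, D z -> cmod (s z - g z) < e]).
  apply/uniform_nbhs.
  exists [set xy : cplx R * cplx R | cmod (xy.1 - xy.2) < e]; split=> //=.
  rewrite -entourage_from_ballE; exists e%:C%C; first by rewrite /= (ltcR 0).
  by move=> [x y]; rewrite /ball /= normE ltcR.
move: entE; rewrite -entourage_from_ballE => -[[e e'] /=].
rewrite ltcE /= => /andP[/eqP -> e0] hE.
apply: filterS (h e e0) => u hu; apply: EP => z Dz; apply: hE => /=.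
by rewrite /ball /= normE ltcR; exact: hu.
Qed.

End UniformSums.

Section AbsUnifSum.
Variables (R : realType) (nu : nat) (T : choiceType) (D : set T).
Local Notation Z := 'rV[int]_nu.

(** The Weierstrass test. *)
Lemma abs_unif_sum_dominated (f : Z -> T -> cplx R) (M : Z -> R) C :
  sum_le M C -> (forall n z, D z -> cmod (f n z) <= M n) ->
  abs_unif_sum D f (fun z => sum (f^~ z)).
Proof.
move=> MC fM; split.
  by move=> z Dz; apply/summable_absP; exact: (abs_summable_le (fun n => fM n z Dz) MC).
apply/uniform_cmodP => e e0.
have [[z0 Dz0]|D0] := pselect (exists z, D z); last first.
  by apply: nearW => J z Dz; case: D0; exists z.
have M0 n : 0 <= M n by apply: le_trans (fM n _ Dz0); exact: cmod_ge0.
have e2 : 0 < e / 2 by rewrite divr_gt0.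
have [J0 hJ] := sum_le_tail M0 MC e2.
apply: filterS (totally_supset J0) => J /= JJ z Dz.
rewrite partial_sumE; apply: (@le_lt_trans _ _ (e / 2)).
  apply: sum_tail_le; first by exact: (abs_summable_le (fun n => fM n z Dz) MC).
  move=> K dK; apply: le_trans (hJ K _); first by apply: ler_sum => n _; exact: fM.
  exact: fdisjointWl dK.
by rewrite ltr_pdivrMr // ltr_pMr // ltr1n.
Qed.

Lemma eq_abs_unif_sum (f : Z -> T -> cplx R) (s s' : T -> cplx R) :
  (forall z, D z -> s z = s' z) -> abs_unif_sum D f s -> abs_unif_sum D f s'.
Proof.
move=> ss [h1 /uniform_cmodP h2]; split=> //; apply/uniform_cmodP => e e0.
by apply: filterS (h2 e e0) => J h z Dz; rewrite -ss //; exact: h.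
Qed.

Lemma abs_unif_sum_abs f (s : T -> cplx R) z : abs_unif_sum D f s -> D z ->
  abs_summable (fun n : Z => f n z).
Proof. by move=> [h _] Dz; apply/summable_absP; exact: h. Qed.

Lemma abs_unif_sumE f (s : T -> cplx R) z : abs_unif_sum D f s -> D z ->
  s z = sum (fun n : Z => f n z).
Proof.
move=> [_ /uniform_cmodP h] Dz; apply/esym/sum_eq_lim/cvg_cmodP => e e0.
apply: filterS (h e e0) => J /(_ z Dz); by rewrite partial_sumE.
Qed.

(** Split the index set according to the sign of the real part, then of the
    imaginary part. *)
Lemma sum_cmod_le_of_subsums (a : Z -> cplx R) (K : {fset Z}) (e : R) :
  (forall K', (K' `<=` K)%fset -> cmod (\sum_(n <- K') a n) <= e) ->
  \sum_(n <- K) cmod (a n) <= 4 * e.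
Proof.
move=> h.
have part (phi : cplx R -> R) : (forall z, `|phi z| <= cmod z) ->
    (forall K', phi (\sum_(n <- K') a n) = \sum_(n <- K') phi (a n)) ->
    \sum_(n <- K) `|phi (a n)| <= 2 * e.
  move=> hphi lin.
  rewrite (big_fsetID _ (fun n => 0 <= phi (a n))) /=.
  set K1 := [fset _ | _ in _ & _]%fset; set K2 := [fset _ | _ in _ & _]%fset.
  have -> : \sum_(i <- K1) `|phi (a i)| = phi (\sum_(i <- K1) a i).
    rewrite lin big_seq [RHS]big_seq; apply: eq_bigr => i.
    by rewrite !inE /= => /andP[_ ?]; rewrite ger0_norm.
  have -> : \sum_(i <- K2) `|phi (a i)| = - phi (\sum_(i <- K2) a i).
    rewrite lin -sumrN big_seq [RHS]big_seq; apply: eq_bigr => i.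
    by rewrite !inE /= -ltNge => /andP[_ ?]; rewrite ltr0_norm.
  have h1 : `|phi (\sum_(i <- K1) a i)| <= e.
    apply: le_trans (hphi _) _; apply: h; apply/fsubsetP => i.
    by rewrite !inE /= => /andP[].
  have h2 : `|phi (\sum_(i <- K2) a i)| <= e.
    apply: le_trans (hphi _) _; apply: h; apply/fsubsetP => i.
    by rewrite !inE /= => /andP[].
  by move: h1 h2; rewrite !ler_norml => /andP[? ?] /andP[? ?]; lra.
have hr := part _ (@Re_le_cmod R) (fun K' => Re_sum K' _ a).
have hi := part _ (@Im_le_cmod R) (fun K' => Im_sum K' _ a).
apply: (@le_trans _ _ (\sum_(n <- K) (`|complex.Re (a n)| + `|complex.Im (a n)|))).
  by apply: ler_sum => n _; exact: cmod_le_ReIm.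
by rewrite big_split /=; lra.
Qed.

(** Uniform convergence along finite subsets bounds every partial sum outside
    some [J0] by 2, hence also the absolute ones.  This controls the l^1 norm
    uniformly in time although the definition only asks for summability at each
    point. *)
Lemma abs_unif_sum_tail f (s : T -> cplx R) : abs_unif_sum D f s ->
  exists J0 : {fset Z}, forall K z, [disjoint J0 & K]%fset -> D z ->
    \sum_(n <- K) cmod (f n z) <= 8.
Proof.
move=> [_ /uniform_cmodP/(_ 1 ltr01)[J0 _ hJ]]; exists J0 => K z dK Dz.
(* 2 bounds the difference of two partial sums at distance at most 1 from
   the limit, and 4 accounts for both signs of the real and the imaginary part. *)
rewrite (_ : 8 = 4 * 2 :> R); last by ring.
apply: sum_cmod_le_of_subsums => K' K'K.
have dK' : [disjoint J0 & K']%fset by apply: fdisjointWr K'K dK.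
have h1 := hJ _ (fsubset_refl J0) z Dz.
have h2 := hJ _ (fsubsetUl J0 K') z Dz.
rewrite partial_sumE in h1; rewrite partial_sumE sum_fsetU // in h2.
set A := \sum_(i <- J0) _ in h1 h2; set B := \sum_(i <- K') _ in h2 *.
have -> : B = (s z - A) - (s z - (A + B)) by ring.
by apply: le_trans (cmodB _ _) _; lra.
Qed.

End AbsUnifSum.

(** * The system of the coefficients *)

Section CoefficientODE.
Variables (R : realType) (nu : nat) (omega : 'rV[R]_nu).
Local Notation Z := 'rV[int]_nu.
Local Notation freq := (freq omega).
Local Notation dx := (dx_coef omega).
Implicit Types (a b : Z -> cplx R) (n : Z).

(** The Fourier multiplier of the inverse of 1 - d^2 followed by d, up to a factor
    i. *)
Definition symbol n : R := freq n / (1 + freq n ^+ 2).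

Lemma symbol_den n : 0 < 1 + freq n ^+ 2.
Proof. by rewrite ltr_pwDl ?sqr_ge0. Qed.

(** The inequality 2 |f| <= 1 + f^2.  It makes the system below an ordinary
    differential equation with a bounded operator in l^1. *)
Lemma symbol_le n : `|symbol n| <= 2^-1.
Proof.
rewrite /symbol normrM normfV (gtr0_norm (symbol_den n)).
rewrite ler_pdivrMr ?symbol_den //.
have := sqr_ge0 (`|freq n| - 1); rewrite sqrrB expr1n mulr1 real_normK ?num_real //; lra.
Qed.

Definition ode_rhs (p : nat) a n : cplx R :=
  - 'i%C * (symbol n)%:C%C * (a n + p%:R^-1 * conv_pow a p.-1 n).

Lemma conv_powS a j : conv_pow a j.+1 = cauchy_prod a (conv_pow a j).
Proof. by []. Qed.

Lemma sum_le_conv_pow a M j : sum_le (fun n => cmod (a n)) M ->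
  sum_le (fun n => cmod (conv_pow a j n)) (M ^+ j.+1).
Proof.
move=> hM; elim: j => [|j IH]; first by rewrite expr1.
by rewrite exprS conv_powS; exact: cauchy_prod_le.
Qed.

(** The difference of two powers telescopes into products with exactly one
    factor [a - b]. *)
Lemma sum_le_conv_powB a b M w j :
  sum_le (fun n => cmod (a n)) M -> sum_le (fun n => cmod (b n)) M ->
  sum_le (fun n => cmod (a n - b n)) w ->
  sum_le (fun n => cmod (conv_pow a j n - conv_pow b j n))
    (j.+1%:R * M ^+ j * w).
Proof.
move=> ha hb hw; elim: j => [|j IH]; first by rewrite expr0 !mul1r.
have sa : abs_summable a by exists M.
have sb : abs_summable b by exists M.
have sA : abs_summable (conv_pow a j) by exact: abs_summable_iter.
have sB : abs_summable (conv_pow b j) by exact: abs_summable_iter.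
have h1 := cauchy_prod_le ha IH.
have h2 := cauchy_prod_le hw (sum_le_conv_pow j hb).
have -> : j.+2%:R * M ^+ j.+1 * w = M * (j.+1%:R * M ^+ j * w) + w * M ^+ j.+1.
  by rewrite -[j.+2]addn1 natrD exprS; ring.
apply: sum_le_mono (sum_leD h1 h2) => n.
rewrite !conv_powS cauchy_prodBr // cauchy_prodBl //.
apply: le_trans (cmodD _ _); rewrite le_eqVlt; apply/orP; left; apply/eqP.
congr cmod; ring.
Qed.

Lemma sum_le_ode_rhsB (p : nat) a b M w : (0 < p)%N ->
  sum_le (fun n => cmod (a n)) M -> sum_le (fun n => cmod (b n)) M ->
  sum_le (fun n => cmod (a n - b n)) w ->
  sum_le (fun n => cmod (ode_rhs p a n - ode_rhs p b n))
    (2^-1 * (1 + M ^+ p.-1) * w).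
Proof.
move=> p0 ha hb hw.
have p0' : (p%:R : R) != 0 by rewrite pnatr_eq0 -lt0n.
have h1 := sum_le_conv_powB p.-1 ha hb hw.
have pV0 : 0 <= (p%:R^-1 : R) by rewrite invr_ge0.
have h2 := sum_leD hw (sum_leZ pV0 h1).
have half0 : 0 <= (2^-1 : R) by rewrite invr_ge0.
have := sum_leZ half0 h2.
rewrite prednK // !mulrA mulVf // mul1r -mulrA mulrDl mul1r.
apply: sum_le_mono => n; rewrite /ode_rhs -mulrBr !cmodM cmodN cmod_i mul1r.
rewrite cmod_real; apply: ler_pM => //; first exact: cmod_ge0.
  exact: symbol_le.
have -> : a n + p%:R^-1 * conv_pow a p.-1 n - (b n + p%:R^-1 * conv_pow b p.-1 n)
  = (a n - b n) + p%:R^-1 * (conv_pow a p.-1 n - conv_pow b p.-1 n) by ring.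
by apply: le_trans (cmodD _ _) _; rewrite cmodM cmodV cmod_nat.
Qed.

Let den_neq0 n : ((1 + freq n ^+ 2)%:C%C : cplx R) != 0.
Proof. by rewrite eq_complex /= gt_eqF ?symbol_den. Qed.

(** The Fourier coefficients of the equation are the residual of the system
    c' = ode_rhs c multiplied by 1 + <n>^2. *)
Lemma residualE (p : nat) a da n : (0 < p)%N ->
  da n - dx (dx da) n + dx a n + p%:R^-1 * dx (conv_pow a p.-1) n =
  (1 + freq n ^+ 2)%:C%C * (da n - ode_rhs p a n).
Proof.
move=> p0; have := den_neq0 n.
rewrite /ode_rhs /symbol /dx_coef rC_mul rC_inv.
have ii : 'i%C * 'i%C = -1 :> cplx R by rewrite -expr2 sqr_i.
have -> : ((1 + freq n ^+ 2)%:C%C : cplx R) =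
    1 - 'i%C * (freq n)%:C%C * ('i%C * (freq n)%:C%C).
  by rewrite mulrACA ii mulN1r opprK -rC_mul rmorphD /= expr2.
move: (freq n)%:C%C (conv_pow a p.-1 n) => f P den; field.
by rewrite den andbT pnatr_eq0 -lt0n.
Qed.

Lemma qp_sum_residual (p : nat) a da x : (0 < p)%N ->
  abs_summable a -> abs_summable (dx a) -> abs_summable da ->
  abs_summable (dx (dx da)) -> abs_summable (nonlin_coef omega p a) ->
  qp_sum omega da x - qp_sum omega (dx (dx da)) x
    + qp_sum omega (dx a) x + qp_sum omega (nonlin_coef omega p a) x =
  qp_sum omega (fun n => (1 + freq n ^+ 2)%:C%C * (da n - ode_rhs p a n)) x.
Proof.
move=> p0 ha hda hd hddd hN.
pose e b m := b m * expi (freq m * x).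
have he b : abs_summable b -> abs_summable (e b) by exact: abs_summable_qp.
have t1 := abs_summableB (he _ hd) (he _ hddd).
have t2 := abs_summableD t1 (he _ hda).
have s1 := sumB (he _ hd) (he _ hddd).
have s2 := sumD t1 (he _ hda); have s3 := sumD t2 (he _ hN).
rewrite s2 s1 in s3; rewrite -[LHS]s3; apply: eq_sum => m.
by rewrite -residualE // -nonlin_coefE // /e; ring.
Qed.

Lemma ode_of_equation (p : nat) a da : (0 < p)%N ->
  nonresonant omega -> abs_summable a -> abs_summable (dx a) ->
  abs_summable da -> abs_summable (dx (dx da)) ->
  abs_summable (nonlin_coef omega p a) ->
  (forall x, qp_sum omega da x - qp_sum omega (dx (dx da)) x
    + qp_sum omega (dx a) x + qp_sum omega (nonlin_coef omega p a) x = 0) ->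
  forall n, da n = ode_rhs p a n.
Proof.
move=> p0 nr ha hda hd hddd hN eq n.
have hg : abs_summable
    (fun n => (1 + freq n ^+ 2)%:C%C * (da n - ode_rhs p a n)).
  have := abs_summableD (abs_summableD (abs_summableB hd hddd) hda) hN.
  congr abs_summable; apply/funext => m.
  by rewrite nonlin_coefE // residualE.
have g0 x := etrans (esym (qp_sum_residual x p0 ha hda hd hddd hN)) (eq x).
have /eqP := qp_sum_eq0 nr hg g0 n.
by rewrite mulf_eq0 (negbTE (den_neq0 n)) subr_eq0 => /eqP.
Qed.

End CoefficientODE.

(** * Uniqueness of classical solutions *)

Section Uniqueness.
Variables (R : realType) (nu : nat) (omega : 'rV[R]_nu) (p : nat) (L : R).
Hypotheses (p0 : (0 < p)%N) (nr : nonresonant omega).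
Local Notation Z := 'rV[int]_nu.
Implicit Types (c dc : R -> Z -> cplx R).

Lemma abs_summable_qp_inv (a : Z -> cplx R) x :
  abs_summable (fun n => a n * expi (freq omega n * x)) -> abs_summable a.
Proof.
by move=> [C hC]; exists C; apply: sum_le_mono hC => n; rewrite cmod_qp_term.
Qed.

Section OneSolution.
Variables (u0 : R -> cplx R) (u ut ux uxx uxxt : R * R -> cplx R).
Variables (c dc : R -> Z -> cplx R).
Hypothesis S : solution_data omega p L u0 u ut ux uxx uxxt c dc.

Lemma solution_ode t : 0 <= t <= L ->
  [/\ abs_summable (c t), forall n, dc t n = ode_rhs omega p (c t) n
    & forall x, u (t, x) = qp_sum omega (c t) x].
Proof.
move=> tL; have Dt (x : R) : (`[0, L] `*` setT)%classic (t, x).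
  by split=> //=; rewrite in_itv.
have su := abs_unif_sum_abs (sol_u S) (Dt 0).
have sut := abs_unif_sum_abs (sol_ut S) (Dt 0).
have sux := abs_unif_sum_abs (sol_ux S) (Dt 0).
have suxxt := abs_unif_sum_abs (sol_uxxt S) (Dt 0).
have sN := abs_unif_sum_abs (sol_nonlin S) (Dt 0).
split; first exact: abs_summable_qp_inv su; last first.
  by move=> x; rewrite (abs_unif_sumE (sol_u S) (Dt x)).
apply: ode_of_equation => //;
  [exact: abs_summable_qp_inv su|exact: abs_summable_qp_inv sux
  |exact: abs_summable_qp_inv sut|exact: abs_summable_qp_inv suxxt
  |exact: abs_summable_qp_inv sN|].
move=> x; rewrite -[RHS](sol_eq S x tL).
rewrite (abs_unif_sumE (sol_nonlin S) (Dt x)) (abs_unif_sumE (sol_ut S) (Dt x)).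
by rewrite (abs_unif_sumE (sol_ux S) (Dt x)) (abs_unif_sumE (sol_uxxt S) (Dt x)).
Qed.

(** Outside a finite set of modes the absolute sums are uniformly bounded; each
    of the remaining modes is continuous on a compact interval. *)
Lemma solution_bounded : 0 <= L ->
  exists M, forall t, 0 <= t <= L -> sum_le (fun n => cmod (c t n)) M.
Proof.
move=> L0; have [J0 hJ] := abs_unif_sum_tail (sol_u S).
have hb n : exists b, forall t, 0 <= t <= L -> cmod (c t n) <= b.
  have [hd _] := sol_C1 S n.
  have cc : {within `[0, L], continuous (fun t => cmod (c t n))}.
    apply/subspace_continuousP => t Dt; apply/cvgrPdist_lt => e e0.
    have /within_continuousP/(_ _ Dt)/cvg_cmodP/(_ _ e0) := deriv_continuous hd.
    apply: filterS => s; apply: le_lt_trans.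
    have h1 := cmodD (c t n - c s n) (c s n).
    have h2 := cmodD (c s n - c t n) (c t n).
    rewrite !subrK (cmodBC (c s n)) in h1 h2.
    change (`|cmod (c t n) - cmod (c s n)| <= cmod (c t n - c s n)).
    by rewrite ler_norml; lra.
  have [s _ hs] := EVT_max L0 cc; exists (cmod (c s n)) => t tL.
  by apply: hs; rewrite in_itv.
have [b hb'] := choice hb.
exists (\sum_(n <- J0) b n + 8) => t tL J.
have Dt : (`[0, L] `*` setT)%classic (t, 0 : R) by split=> //=; rewrite in_itv.
rewrite (big_fsetID _ (mem J0)) /=; apply: lerD.
  apply: (@le_trans _ _ (\sum_(n <- J0) cmod (c t n))).
    apply: sum_le_sub => [n|]; first exact: cmod_ge0.
    by apply/fsubsetP => n; rewrite !inE /= => /andP[].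
  by apply: ler_sum => n _; exact: hb'.
have E n : cmod (qp_term omega c n (t, 0)) = cmod (c t n).
  exact: (cmod_qp_term omega (c t) 0 n).
rewrite (eq_bigr _ (fun n _ => esym (E n))); apply: (hJ _ _ _ Dt).
by apply/fdisjointP => n nJ; rewrite !inE /= nJ andbF.
Qed.

End OneSolution.

Lemma deriv_on_monomial (D : set R) (k : nat) :
  deriv_on D (fun t => (t ^+ k.+1)%:C%C) (fun t => (k.+1%:R * t ^+ k)%:C%C).
Proof.
have hid : deriv_on D (fun t => t%:C%C) (fun=> 1%:C%C).
  by apply: is_derive_deriv_on => t _; exact: is_derive_id.
elim: k => [|k IH].
  by apply: (eq_deriv_on _ _ hid) => t _; rewrite ?expr1 // expr0 mulr1.
apply: (eq_deriv_on _ _ (deriv_onM hid IH)) => t _.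
  by rewrite -rC_mul -exprS.
by rewrite -!rC_mul -rmorphD /=; congr (_%:C)%C; rewrite -[k.+2]add1n natrD exprS; ring.
Qed.

Lemma itv_interval : is_interval (`[0, L]%classic : set R).
Proof.
move=> x y /=; rewrite !in_itv /= => /andP[x1 x2] /andP[y1 y2] z /andP[z1 z2].
by rewrite in_itv /= (le_trans x1 z1) (le_trans z2 y2).
Qed.

(** Integrating the Lipschitz bound of [ode_rhs] k times shows that the l^1
    distance of two solutions is at most 2 M (K t)^k / k!, for every k. *)
Lemma ode_unique c d (M : R) : 0 <= L ->
  (forall n, deriv_on `[0, L] (c^~ n) (fun t => ode_rhs omega p (c t) n)) ->
  (forall n, deriv_on `[0, L] (d^~ n) (fun t => ode_rhs omega p (d t) n)) ->
  (forall t, 0 <= t <= L -> sum_le (fun n => cmod (c t n)) M) ->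
  (forall t, 0 <= t <= L -> sum_le (fun n => cmod (d t n)) M) ->
  (forall n, c 0 n = d 0 n) ->
  forall t, 0 <= t <= L -> forall n, c t n = d t n.
Proof.
move=> L0 hc hd bc bd c0.
have L00 : 0 <= (0 : R) <= L by rewrite lexx.
have M0 := sum_le_ge0 (bc _ L00).
pose K := 2^-1 * (1 + M ^+ p.-1).
have main k : forall t, 0 <= t <= L ->
    sum_le (fun n => cmod (c t n - d t n)) (2 * M * exp_coeff (K * t) k).
  elim: k => [|k IH] t tL.
    rewrite exp_coeffE fact0 invr1 mul1r mulr1.
    have -> : 2 * M = M + M by ring.
    by apply: sum_le_mono (sum_leD (bc _ tL) (bd _ tL)) => n; exact: cmodB.
  move=> J; have [t0 _] := andP tL.
  (* The numbers [ep n] turn the sum of the moduli at time [t] into the real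
     part of a linear functional, which can be differentiated in time. *)
  pose w n := c t n - d t n.
  pose ep n : cplx R := if w n == 0 then 0 else (cmod (w n))%:C%C / w n.
  have epw n : ep n * w n = (cmod (w n))%:C%C.
    rewrite /ep; case: eqVneq => [->|w0]; first by rewrite mul0r cmod0.
    by rewrite divfK.
  have ep1 n : cmod (ep n) <= 1.
    rewrite /ep; case: eqVneq => [_|w0]; first by rewrite cmod0 ler01.
    have cw : cmod (w n) != 0 by apply: contra_neq w0 => /cmod_eq0.
    by rewrite cmodM cmodV cmod_real ger0_norm ?cmod_ge0 // divff.
  pose B := 2 * M * (K ^+ k.+1 / (k.+1)`!%:R).
  have h1 := deriv_on_finsum (s := J)
    (fun n => deriv_onZ (ep n) (deriv_onB (hc n) (hd n))).
  have h2 := deriv_onB h1 (deriv_onZ B%:C%C (@deriv_on_monomial `[0, L] k)).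
  have Ds s : `[0, L]%classic s -> 0 <= s <= L by rewrite /= in_itv.
  have D0 : `[0, L]%classic (0 : R) by rewrite /= in_itv.
  have Dt : `[0, L]%classic t by rewrite /= in_itv.
  have := deriv_on_Re_nincr itv_interval h2 _ D0 Dt t0.
  have neg s : `[0, L]%classic s -> complex.Re
      (\sum_(n <- J) ep n * (ode_rhs omega p (c s) n - ode_rhs omega p (d s) n)
       - B%:C%C * (k.+1%:R * s ^+ k)%:C%C) <= 0.
    move=> /Ds sL; rewrite ReD ReN -rC_mul /= subr_le0.
    apply: le_trans (ler_norm _) _; apply: le_trans (Re_le_cmod _) _.
    apply: le_trans (cmod_sum _ _ _) _.
    have := sum_le_ode_rhsB omega p0 (bc _ sL) (bd _ sL) (IH _ sL).
    move=> /(_ J); rewrite -/K.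
    have -> : B * (k.+1%:R * s ^+ k) = K * (2 * M * exp_coeff (K * s) k).
      rewrite /B exp_coeffE factS natrM [(K * s) ^+ k]exprMn [K ^+ k.+1]exprS.
      have f0 : k`!%:R != 0 :> R by rewrite pnatr_eq0 -lt0n fact_gt0.
      by field; rewrite f0 addrC natr1 pnatr_eq0.
    apply: le_trans; apply: ler_sum => n _.
    by rewrite cmodM ler_piMl ?cmod_ge0.
  move=> /(_ neg); rewrite !ReD !ReN -!rC_mul /= expr0n /= mulr0 subr0.
  rewrite [X in _ - _ <= complex.Re X]big1; last first.
    by move=> n _; rewrite c0 subrr mulr0.
  rewrite subr_le0 Re_sum; congr (_ <= _).
    by apply: eq_bigr => n _; rewrite epw.
  by rewrite /B exp_coeffE [(K * t) ^+ _]exprMn; ring.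
move=> t tL n; apply/eqP; rewrite -subr_eq0; apply/eqP/cmod_eq0/eqP.
rewrite eq_le cmod_ge0 andbT.
have lim0 : (fun k => 2 * M * exp_coeff (K * t) k) @ \oo --> 2 * M * 0.
  by apply: cvgM; [exact: cvg_cst|exact: cvg_exp_coeff].
rewrite mulr0 in lim0; apply: (cvgr_to_ge lim0).
apply: nearW => k; have := main k t tL [fset n]%fset.
by rewrite big_seq_fset1.
Qed.
Lemma classical_solution_unique (u0 : R -> cplx R) (u v : R * R -> cplx R) :
  0 <= L ->
  classical_solution omega p L u0 u -> classical_solution omega p L u0 v ->
  forall t x, 0 <= t <= L -> v (t, x) = u (t, x).
Proof.
move=> L0 [ut [ux [uxx [uxxt [c [dc S]]]]]] [vt [vx [vxx [vxxt [d [dd S']]]]]].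
have L00 : 0 <= (0 : R) <= L by rewrite lexx.
have [M1 hM1] := solution_bounded S L0; have [M2 hM2] := solution_bounded S' L0.
have ode w wt wx wxx wxxt e de :
    solution_data omega p L u0 w wt wx wxx wxxt e de ->
    forall n, deriv_on `[0, L] (e^~ n) (fun t => ode_rhs omega p (e t) n).
  move=> Se n; have [h _] := sol_C1 Se n.
  apply: (eq_deriv_on _ _ h) => // t; rewrite /= in_itv /= => tL.
  by have [_ -> _] := solution_ode Se tL.
have init n : c 0 n = d 0 n.
  have [hc _ uE] := solution_ode S L00; have [hd _ vE] := solution_ode S' L00.
  apply/eqP; rewrite -subr_eq0; apply/eqP.
  apply: (qp_sum_eq0 nr (abs_summableB hc hd)) => x.
  transitivity (qp_sum omega (c 0) x - qp_sum omega (d 0) x); last first.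
    by rewrite -uE -vE (sol_init S) (sol_init S') subrr.
  rewrite /qp_sum -sumB; [|exact: abs_summable_qp|exact: abs_summable_qp].
  by apply: eq_sum => m; rewrite mulrBl.
have cd := ode_unique (M := Num.max M1 M2) L0 (ode _ _ _ _ _ _ _ S)
  (ode _ _ _ _ _ _ _ S') _ _ init.
move=> t x tL; have [_ _ ->] := solution_ode S tL.
have [_ _ ->] := solution_ode S' tL; apply: eq_sum => n.
by rewrite cd // => s sL J; [apply: le_trans (hM1 s sL J) _|
  apply: le_trans (hM2 s sL J) _]; rewrite le_max lexx ?orbT.
Qed.

End Uniqueness.

(** * Convolution of majorants *)

Section RealMajorants.
Variables (R : realType) (nu : nat).
Local Notation Z := 'rV[int]_nu.
Implicit Types (A B : Z -> R) (a b : Z -> cplx R) (n m : Z).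

Definition embed A : Z -> cplx R := fun n => (A n)%:C%C.

(** The Cauchy product of real families; taking the real part only forgets that
    the value, a sum of real numbers, is complex. *)
Definition rconv A B n : R := complex.Re (cauchy_prod (embed A) (embed B) n).

Definition rpow A (j : nat) := iter j (rconv A) A.

Lemma rpowS A j : rpow A j.+1 = rconv A (rpow A j).
Proof. by []. Qed.

Definition dominated a A := forall n, cmod (a n) <= A n.

Definition rsummable A := abs_summable (embed A).

Lemma dominated_ge0 a A n : dominated a A -> 0 <= A n.
Proof. by move=> h; apply: le_trans (h n); exact: cmod_ge0. Qed.

Lemma dominated_embed A : (forall n, 0 <= A n) -> dominated (embed A) A.
Proof. by move=> A0 n; rewrite cmod_real ger0_norm. Qed.

Lemma dominated_summable a A : dominated a A -> rsummable A -> abs_summable a.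
Proof.
move=> h [C hC]; exists C; apply: sum_le_mono hC => n.
by rewrite cmod_real; apply: le_trans (h n) (ler_norm _).
Qed.

Lemma rconv_dom a b A B : dominated a A -> dominated b B ->
  rsummable A -> rsummable B -> dominated (cauchy_prod a b) (rconv A B).
Proof.
move=> ha hb sA sB n; apply: cmod_sum_maj => [m|].
  by rewrite -rC_mul cmodM ler_pM ?cmod_ge0.
exact: abs_summable_conv_term.
Qed.

Lemma rsummable_rconv A B : rsummable A -> rsummable B -> rsummable (rconv A B).
Proof.
move=> sA sB; have [C hC] := abs_summable_conv sA sB; exists C.
by apply: sum_le_mono hC => n; rewrite cmod_real; exact: Re_le_cmod.
Qed.

Lemma rsummable_rpow A j : rsummable A -> rsummable (rpow A j).
Proof. by move=> sA; elim: j => // j IH; exact: rsummable_rconv. Qed.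

Lemma rsummableB A B : rsummable A -> rsummable B ->
  rsummable (fun n => A n - B n).
Proof.
move=> sA sB; have := abs_summableB sA sB; congr abs_summable.
by apply/funext => n; rewrite /embed rC_sub.
Qed.

Lemma rconvBl A A' B n : rsummable A -> rsummable A' -> rsummable B ->
  rconv (fun m => A m - A' m) B n = rconv A B n - rconv A' B n.
Proof.
move=> sA sA' sB; rewrite /rconv -ReN -ReD -cauchy_prodBl //.
by congr (complex.Re (cauchy_prod _ _ _)); apply/funext => m; rewrite /embed rC_sub.
Qed.

Lemma rconvBr A B B' n : rsummable A -> rsummable B -> rsummable B' ->
  rconv A (fun m => B m - B' m) n = rconv A B n - rconv A B' n.
Proof.
move=> sA sB sB'; rewrite /rconv -ReN -ReD -cauchy_prodBr //.
by congr (complex.Re (cauchy_prod _ _ _)); apply/funext => m; rewrite /embed rC_sub.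
Qed.

Lemma rpow_dom a A j : dominated a A -> rsummable A ->
  dominated (conv_pow a j) (rpow A j).
Proof.
move=> ha sA; elim: j => // j IH; apply: rconv_dom => //.
exact: rsummable_rpow.
Qed.

(** Cauchy's method of majorants.  Writing b b' - a a' as b (b' - a') +
    (b - a) a', every factor is dominated by its counterpart in
    B B' - A A'. *)
Lemma rpow_domB a b A B j : dominated a A -> dominated b B ->
  dominated (fun n => b n - a n) (fun n => B n - A n) ->
  rsummable A -> rsummable B ->
  dominated (fun n => conv_pow b j n - conv_pow a j n)
    (fun n => rpow B j n - rpow A j n).
Proof.
move=> ha hb hd sA sB; elim: j => // j IH n.
have sa := dominated_summable ha sA; have sb := dominated_summable hb sB.
have spa : abs_summable (conv_pow a j) by exact: abs_summable_iter.
have spb : abs_summable (conv_pow b j) by exact: abs_summable_iter.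
have sPA := rsummable_rpow j sA; have sPB := rsummable_rpow j sB.
have h1 := rconv_dom hb IH sB (rsummableB sPB sPA) n.
have h2 := rconv_dom hd (rpow_dom j ha sA) (rsummableB sB sA) sPA n.
rewrite (cauchy_prodBr sb spb spa) (rconvBr n sB sPB sPA) in h1.
rewrite (cauchy_prodBl sb sa spa) (rconvBl n sB sA sPA) in h2.
rewrite !conv_powS !rpowS.
have -> : cauchy_prod b (conv_pow b j) n - cauchy_prod a (conv_pow a j) n =
  (cauchy_prod b (conv_pow b j) n - cauchy_prod b (conv_pow a j) n) +
  (cauchy_prod b (conv_pow a j) n - cauchy_prod a (conv_pow a j) n).
  by rewrite addrA subrK.
apply: le_trans (cmodD _ _) _; apply: le_trans (lerD h1 h2) _.
rewrite addrA subrK; exact: lexx.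
Qed.

Section Weight.
Variable w : Z -> R.
Hypotheses (w1 : forall n, 1 <= w n) (wM : forall n m, w n <= w m * w (n - m)).

Lemma weighted_le (A : Z -> R) C : (forall n, 0 <= A n) ->
  sum_le (fun n => w n * A n) C -> sum_le A C.
Proof. by move=> A0; apply: sum_le_mono => n; rewrite ler_peMl. Qed.

Lemma weighted_rsummable A C : (forall n, 0 <= A n) ->
  sum_le (fun n => w n * A n) C -> rsummable A.
Proof.
move=> A0 h; exists C; apply: sum_le_mono (weighted_le A0 h) => n.
by rewrite cmod_real ger0_norm.
Qed.

Lemma rpow_ge0 A j n : (forall n, 0 <= A n) -> rsummable A -> 0 <= rpow A j n.
Proof.
by move=> A0 sA; exact: dominated_ge0 (rpow_dom j (dominated_embed A0) sA).
Qed.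

Lemma rpow_weighted A C j : (forall n, 0 <= A n) ->
  sum_le (fun n => w n * A n) C -> sum_le (fun n => w n * rpow A j n) (C ^+ j.+1).
Proof.
move=> A0 hA; have sA := weighted_rsummable A0 hA.
elim: j => [|j IH]; first by rewrite expr1.
have w0 n : 0 <= w n by apply: le_trans (w1 n).
have hA' : sum_le (fun n => w n * cmod (embed A n)) C.
  by apply: sum_le_mono hA => n; rewrite cmod_real ger0_norm.
have hB' : sum_le (fun n => w n * cmod (embed (rpow A j) n)) (C ^+ j.+1).
  by apply: sum_le_mono IH => n; rewrite cmod_real ger0_norm // rpow_ge0.
have := cauchy_prod_wle w0 wM hA' hB' sA (rsummable_rpow j sA).
rewrite -exprS; apply: sum_le_mono => n; rewrite ler_wpM2l //.
by apply: le_trans (ler_norm _) (Re_le_cmod _).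
Qed.

End Weight.

Lemma cvg_conv (T : Type) (F : set_system T) {FF : Filter F}
    (a b : T -> Z -> cplx R) (a' b' : Z -> cplx R) A B n :
  (\forall t \near F, dominated (a t) A) -> (\forall t \near F, dominated (b t) B) ->
  dominated a' A -> dominated b' B -> rsummable A -> rsummable B ->
  (forall m, (a^~ m) @ F --> a' m) -> (forall m, (b^~ m) @ F --> b' m) ->
  (fun t => cauchy_prod (a t) (b t) n) @ F --> cauchy_prod a' b' n.
Proof.
move=> aA bB a'A b'B sA sB ha hb.
have [C hC] := abs_summable_conv_term n sA sB.
apply: (tannery hC).
- apply: filterS2 aA bB => t h1 h2 m; rewrite -rC_mul cmod_real.
  apply: le_trans (ler_norm _); rewrite cmodM ler_pM ?cmod_ge0 //.
- move=> m; rewrite -rC_mul cmod_real.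
  apply: le_trans (ler_norm _); rewrite cmodM ler_pM ?cmod_ge0 //.
- by move=> m; apply: cvg_cplxM; [exact: ha|exact: hb].
Qed.

Lemma cvg_conv_pow (T : Type) (F : set_system T) {FF : Filter F}
    (a : T -> Z -> cplx R) (a' : Z -> cplx R) A j :
  (\forall t \near F, dominated (a t) A) -> dominated a' A -> rsummable A ->
  (forall m, (a^~ m) @ F --> a' m) ->
  forall n, (fun t => conv_pow (a t) j n) @ F --> conv_pow a' j n.
Proof.
move=> aA a'A sA ha; elim: j => [|j IH] n; first exact: ha.
have h := @cvg_conv _ _ _ a (fun t => conv_pow (a t) j) a' (conv_pow a' j) A
  (rpow A j) n aA.
apply: h; [|exact: a'A| |exact: sA| |exact: ha|exact: IH].
- by apply: filterS aA => t h; exact: rpow_dom.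
- exact: rpow_dom.
- exact: rsummable_rpow.
Qed.

Lemma embed_rpow_dom A M j : dominated (embed A) M -> rsummable M ->
  dominated (embed (rpow A j)) (rpow M j).
Proof.
move=> hA sM; elim: j => [|j IH]; first exact: hA.
move=> n; rewrite !rpowS cmod_real; apply: le_trans (Re_le_cmod _) _.
by apply: (rconv_dom hA IH sM (rsummable_rpow j sM)).
Qed.

Lemma cvg_rpow (T : Type) (F : set_system T) {FF : Filter F}
    (A : T -> Z -> R) (A' : Z -> R) M j :
  (\forall t \near F, dominated (embed (A t)) M) -> dominated (embed A') M ->
  rsummable M -> (forall m, (A^~ m) @ F --> A' m) ->
  forall n, (fun t => rpow (A t) j n) @ F --> rpow A' j n.
Proof.
move=> AM A'M sM hA; elim: j => [|j IH] n; first exact: hA.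
apply: cvg_Re; have h := @cvg_conv _ _ _ (fun t => embed (A t))
  (fun t => embed (rpow (A t) j)) (embed A') (embed (rpow A' j)) M (rpow M j) n AM.
apply: h; [|exact: A'M| |exact: sM| | |].
- by apply: filterS AM => t h; exact: embed_rpow_dom.
- exact: embed_rpow_dom.
- exact: rsummable_rpow.
- by move=> m; apply: cvg_rC; exact: hA.
- by move=> m; apply: cvg_rC; exact: IH.
Qed.

(** For a real sequence [x], both [b] and [x + b] are nondecreasing and
    bounded; real and imaginary parts reduce to this case. *)
Lemma telescoping_cvg (x : nat -> cplx R) (b : nat -> R) (rho : R) :
  (forall k, cmod (x k.+1 - x k) <= b k.+1 - b k) -> (forall k, b k <= rho) ->
  (forall k, cmod (x k) <= b k) ->
  exists l : cplx R, x @ \oo --> l.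
Proof.
move=> xb brho xb0.
have bcvg : b @ \oo --> sup (range b).
  apply: nondecreasing_cvgn; last by exists rho => _ [k _ <-].
  apply/nondecreasing_seqP => k; rewrite -subr_ge0.
  by apply: le_trans (xb k); exact: cmod_ge0.
have part (phi : cplx R -> R) : (forall z, `|phi z| <= cmod z) ->
    (forall y z, phi (y - z) = phi y - phi z) ->
    exists l : R, (phi \o x) @ \oo --> l.
  move=> hphi lin; pose y k := phi (x k) + b k.
  have ycvg : y @ \oo --> sup (range y).
    apply: nondecreasing_cvgn; last first.
      exists (rho + rho) => _ [k _ <-]; apply: lerD => //.
      apply: le_trans (ler_norm _) _; apply: le_trans (hphi _) _.
      by apply: le_trans (brho k).
    apply/nondecreasing_seqP => k; rewrite /y.
    have := hphi (x k.+1 - x k); have := xb k; rewrite lin ler_norml; lra.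
  exists (sup (range y) - sup (range b)); apply: cvg_trans (cvgB ycvg bcvg).
  by apply: near_eq_cvg; apply: nearW => k; rewrite /y /= !fctE addrK.
have [l1 h1] := part _ (@Re_le_cmod R) (fun y z => etrans (ReD y (- z)) (congr1 _ (ReN z))).
have [l2 h2] := part _ (@Im_le_cmod R) (fun y z => etrans (ImD y (- z)) (congr1 _ (ImN z))).
exists (l1%:C%C + 'i%C * l2%:C%C).
apply: cvg_trans (cvg_cplxD (cvg_rC h1) (cvg_cplxM (cvg_cst _) (cvg_rC h2))).
by apply: near_eq_cvg; apply: nearW => k; rewrite /= -complexE.
Qed.

End RealMajorants.

(** * Picard iteration *)

Section Picard.
Variables (R : realType) (nu : nat) (omega : 'rV[R]_nu) (p : nat) (L : R).
Hypotheses (p0 : (0 < p)%N) (L0 : 0 <= L).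
Local Notation Z := 'rV[int]_nu.
Local Notation sigma := (symbol omega).
Local Notation I := (`[0, L]%classic : set R).

Lemma time_itvE t : I t = (0 <= t <= L) :> Prop.
Proof. by rewrite /= in_itv. Qed.

Lemma time_itv0 : I 0.
Proof. by rewrite time_itvE lexx. Qed.

(** The linear part rotates each mode, so after multiplication by e^(i s t) only
    the forcing contributes to the derivative. *)
Lemma duhamel_le (s : R) (y g : R -> cplx R) (G : R) t :
  deriv_on I y (fun t => - 'i%C * s%:C%C * y t + g t) ->
  (forall t, I t -> cmod (g t) <= G) -> I t ->
  cmod (y t) <= cmod (y 0) + L * G.
Proof.
move=> hy hg It.
have hz : deriv_on I (fun t => expi (s * t) * y t)
    (fun t => expi (s * t) * g t).
  by apply: (eq_deriv_on _ _ (deriv_onM (@deriv_on_expi R I s) hy)) => // u _; ring.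
have h : cmod (expi (s * t) * y t - expi (s * 0) * y 0) <= G * `|t - 0|.
  apply: (deriv_on_lip (@itv_interval R L) hz _ time_itv0 It) => u Iu.
  by rewrite cmodM cmod_expi mul1r; exact: hg.
have G0 : 0 <= G by apply: le_trans (hg _ It); exact: cmod_ge0.
have [t0 tL] : 0 <= t /\ t <= L by move: It; rewrite time_itvE => /andP[].
have : G * `|t - 0| <= L * G by rewrite subr0 ger0_norm // mulrC ler_wpM2r.
have := cmodD (expi (s * t) * y t - expi (s * 0) * y 0) (expi (s * 0) * y 0).
by rewrite subrK !cmodM !cmod_expi !mul1r; lra.
Qed.

(** Variation of constants, with integrating factor e^(i s t). *)
Lemma linear_ode_exists (s : R) (f : R -> cplx R) (y0 : cplx R) :
  {within I, continuous f} ->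
  exists y, deriv_on I y (fun t => - 'i%C * s%:C%C * (y t + f t)) /\ y 0 = y0.
Proof.
move=> cf; pose h t := expi (s * t) * (- 'i%C * s%:C%C * f t).
have ch : {within I, continuous h}.
  apply/within_continuousP => t It; apply: cvg_cplxM.
    have /within_continuousP := deriv_continuous (@deriv_on_expi R I s).
    exact.
  by apply: cvg_cplxM; [exact: cvg_cst|move/within_continuousP : cf; apply].
have [F [F0 dF]] := primitive_exists L0 ch.
exists (fun t => expi (- s * t) * (y0 + F t)); split; last first.
  by rewrite mulr0 expi0 F0 addr0 mul1r.
have := deriv_onM (@deriv_on_expi R I (- s)) (deriv_onD (deriv_on_cst y0) dF).
apply: eq_deriv_on => // t _.
have e : expi (- s * t) * expi (s * t) = 1 :> cplx R.
  by rewrite -expiD mulNr addNr expi0.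
have e' (x : cplx R) : expi (- s * t) * (expi (s * t) * x) = x.
  by rewrite mulrA e mul1r.
rewrite /h add0r e' rmorphN /=.
move: (expi (- s * t)) (F t) (f t) => E F' f'; ring.
Qed.

Variable uhat : Z -> cplx R.

(** [c'] solves the linear problem whose forcing is the nonlinear term of [c].
    Keeping the linear term implicit prevents it from entering the estimates,
    so that smallness is only asked of the nonlinear term. *)
Definition picard_step (c c' : R -> Z -> cplx R) : Prop := forall n,
  deriv_on I (c'^~ n) (fun t => - 'i%C * (sigma n)%:C%C *
    (c' t n + p%:R^-1 * conv_pow (c t) p.-1 n)) /\ c' 0 n = uhat n.

Definition picard (c : R -> Z -> cplx R) : R -> Z -> cplx R :=
  if pselect (exists c', picard_step c c') is left h then projT1 (cid h)
  else fun _ _ => 0.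

(** The length of the interval times the bound of the multiplier, divided by
    [p]. *)
Definition kappa : R := L * (2^-1 * p%:R^-1).

Lemma kappa_ge0 : 0 <= kappa.
Proof. by rewrite /kappa !mulr_ge0 // invr_ge0. Qed.

Lemma conv_pow_continuous (c : R -> Z -> cplx R) (A : Z -> R) j :
  (forall n, {within I, continuous (c^~ n)}) ->
  (forall t, I t -> dominated (c t) A) -> rsummable A ->
  forall n, {within I, continuous (fun t => conv_pow (c t) j n)}.
Proof.
move=> cc dc sA n; apply/within_continuousP => t It.
apply: (cvg_conv_pow _ (A := A)) => //.
- by apply: filterS (withinT _ _) => s; exact: dc.
- exact: dc.
- by move=> m; move/within_continuousP : (cc m); apply.
Qed.

Lemma picardP (c : R -> Z -> cplx R) (A : Z -> R) :
  (forall n, {within I, continuous (c^~ n)}) ->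
  (forall t, I t -> dominated (c t) A) -> rsummable A ->
  picard_step c (picard c).
Proof.
move=> cc dc sA; rewrite /picard; case: pselect => [h|[]].
  by case: cid.
have ex n : exists y, deriv_on I y (fun t => - 'i%C * (sigma n)%:C%C *
    (y t + p%:R^-1 * conv_pow (c t) p.-1 n)) /\ y 0 = uhat n.
  apply: linear_ode_exists; apply/within_continuousP => t It.
  apply: cvg_cplxM; first exact: cvg_cst.
  by have /within_continuousP := @conv_pow_continuous c A p.-1 cc dc sA n; apply.
by have [y hy] := choice ex; exists (fun t n => y n t).
Qed.

Lemma forcing_le n (z : cplx R) (G : R) : cmod z <= G ->
  cmod (- 'i%C * (sigma n)%:C%C * (p%:R^-1 * z)) <= 2^-1 * p%:R^-1 * G.
Proof.
move=> zG; rewrite !cmodM cmodN cmod_i mul1r cmod_real cmodV cmod_nat mulrA.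
apply: ler_pM => //; rewrite ?cmod_ge0 ?mulr_ge0 ?invr_ge0 //.
by rewrite ler_wpM2r ?invr_ge0 // symbol_le.
Qed.

Lemma picard_step_le c c' (G : R) n : picard_step c c' ->
  (forall t, I t -> cmod (conv_pow (c t) p.-1 n) <= G) ->
  forall t, I t -> cmod (c' t n) <= cmod (uhat n) + kappa * G.
Proof.
move=> /(_ n)[hc <-] hG t It; rewrite /kappa -mulrA.
apply: (@duhamel_le (sigma n) (c'^~ n) (fun t => - 'i%C * (sigma n)%:C%C *
  (p%:R^-1 * conv_pow (c t) p.-1 n))) It.
  by apply: (eq_deriv_on _ _ hc) => // s _; rewrite mulrDr.
by move=> s Is; exact: forcing_le (hG s Is).
Qed.

Lemma picard_stepB_le c c' d d' (G : R) n :
  picard_step c c' -> picard_step d d' ->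
  (forall t, I t ->
     cmod (conv_pow (c t) p.-1 n - conv_pow (d t) p.-1 n) <= G) ->
  forall t, I t -> cmod (c' t n - d' t n) <= kappa * G.
Proof.
move=> /(_ n)[hc c0] /(_ n)[hd d0] hG t It.
have -> : kappa * G = cmod (c' 0 n - d' 0 n) + L * (2^-1 * p%:R^-1 * G).
  by rewrite c0 d0 subrr cmod0 add0r /kappa -mulrA.
apply: (@duhamel_le (sigma n) (fun t => c' t n - d' t n)
  (fun t => - 'i%C * (sigma n)%:C%C *
     (p%:R^-1 * (conv_pow (c t) p.-1 n - conv_pow (d t) p.-1 n)))) It.
  apply: (eq_deriv_on _ _ (deriv_onB hc hd)) => // s _.
  move: (conv_pow (c s) p.-1 n) (conv_pow (d s) p.-1 n) => P Q; ring.
by move=> s Is; exact: forcing_le (hG s Is).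
Qed.

Variables (w : Z -> R) (y0 rho : R).
Hypotheses (w1 : forall n, 1 <= w n) (wM : forall n m, w n <= w m * w (n - m)).
Hypothesis uhat_le : sum_le (fun n => w n * cmod (uhat n)) y0.
Hypotheses (rho0 : 0 <= rho) (rho_le : y0 + kappa * rho ^+ p <= rho).

Definition iterate (k : nat) : R -> Z -> cplx R := iter k picard (fun _ _ => 0).

Definition majorant (k : nat) : Z -> R :=
  iter k (fun B n => cmod (uhat n) + kappa * rpow B p.-1 n) (fun=> 0).

(** The majorants stay in the ball of radius [rho] of the weighted l^1 space,
    by the hypothesis on [rho]. *)
Lemma majorant_ok k :
  (forall n, 0 <= majorant k n) /\ sum_le (fun n => w n * majorant k n) rho.
Proof.
elim: k => [|k [IH0 IH]].
  by split=> // J; rewrite big1 // => n _; rewrite mulr0.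
have sB := weighted_rsummable w1 IH0 IH.
have k0 := kappa_ge0; split=> [n|].
  by rewrite addr_ge0 ?cmod_ge0 // mulr_ge0 // rpow_ge0.
have h := sum_leD uhat_le (sum_leZ k0 (rpow_weighted w1 wM p.-1 IH0 IH)).
rewrite prednK // in h => J; apply: le_trans rho_le; apply: le_trans (h J).
apply: ler_sum => n _; rewrite /= mulrDr lerD2l mulrCA; exact: lexx.
Qed.

Lemma majorant_ge0 k n : 0 <= majorant k n.
Proof. exact: (majorant_ok k).1. Qed.

Lemma majorant_summable k : rsummable (majorant k).
Proof. by have [h1 h2] := majorant_ok k; exact: (weighted_rsummable w1 h1 h2). Qed.

Lemma majorantS k n :
  majorant k.+1 n = cmod (uhat n) + kappa * rpow (majorant k) p.-1 n.
Proof. by []. Qed.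

Lemma iterate_ok k :
  [/\ forall n, {within I, continuous ((iterate k)^~ n)},
      forall t, I t -> dominated (iterate k t) (majorant k) &
      picard_step (iterate k) (iterate k.+1)].
Proof.
elim: k => [|k [IH1 IH2 IH3]].
  have c0 n : {within I, continuous ((iterate 0)^~ n)}.
    by apply/within_continuousP => t It; exact: cvg_cst.
  have d0 t : I t -> dominated (iterate 0 t) (majorant 0).
    by move=> _ n; rewrite cmod0.
  split; [exact: c0|exact: d0|exact: (picardP c0 d0 (majorant_summable 0))].
have c1 n : {within I, continuous ((iterate k.+1)^~ n)}.
  by have [h _] := IH3 n; exact: deriv_continuous h.
have d1 t : I t -> dominated (iterate k.+1 t) (majorant k.+1).
  move=> It n; rewrite majorantS; apply: (picard_step_le IH3) It => s Is.
  exact: (rpow_dom p.-1 (IH2 s Is) (majorant_summable k)).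
split; [exact: c1|exact: d1|exact: (picardP c1 d1 (majorant_summable k.+1))].
Qed.

(** The increments of the iterates are dominated by those of the majorants.
    Convergence of the monotone and bounded majorants therefore forces that of
    the iterates, uniformly in time. *)
Lemma iterateB_le k t : I t ->
  dominated (fun n => iterate k.+1 t n - iterate k t n)
    (fun n => majorant k.+1 n - majorant k n).
Proof.
elim: k t => [|k IH] t It n.
  have [_ /(_ t It n) h _] := iterate_ok 1.
  by rewrite subr0 (_ : majorant 0 n = 0) // subr0.
have [_ d0 s0] := iterate_ok k; have [_ d1 s1] := iterate_ok k.+1.
have -> : majorant k.+2 n - majorant k.+1 n = kappa *
    (rpow (majorant k.+1) p.-1 n - rpow (majorant k) p.-1 n).
  by rewrite (majorantS k.+1) (majorantS k) mulrBr opprD addrACA subrr add0r.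
apply: (picard_stepB_le s1 s0) It => s Is.
exact: (rpow_domB p.-1 (d0 s Is) (d1 s Is) (IH s Is)
  (majorant_summable k) (majorant_summable k.+1)).
Qed.

Lemma majorant_le k n : majorant k n <= rho.
Proof.
have [h0 h] := majorant_ok k.
exact: (@sum_le_ub _ _ _ _ n h0 (weighted_le w1 h0 h)).
Qed.

Lemma majorant_mono k n : majorant k n <= majorant k.+1 n.
Proof.
by rewrite -subr_ge0; exact: (dominated_ge0 n (iterateB_le k time_itv0)).
Qed.

Definition majorant_lim n : R := sup (range (fun k => majorant k n)).

Lemma majorant_cvg n : (fun k => majorant k n) @ \oo --> majorant_lim n.
Proof.
apply: nondecreasing_cvgn; last by exists rho => _ [k _ <-]; exact: majorant_le.
by apply/nondecreasing_seqP => k; exact: majorant_mono.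
Qed.

Lemma majorant_lim_ge k n : majorant k n <= majorant_lim n.
Proof.
apply: sup_upper_bound; last by exists k.
split; first by exists (majorant 0 n), 0%N.
by exists rho => _ [j _ <-]; exact: majorant_le.
Qed.

Lemma majorant_lim_weighted : sum_le (fun n => w n * majorant_lim n) rho.
Proof.
move=> J; have h : (fun k => \sum_(n <- J) w n * majorant k n) @ \oo -->
    \sum_(n <- J) w n * majorant_lim n.
  elim: (J : seq Z) => [|n s IH].
    rewrite big_nil; under eq_fun do rewrite big_nil; exact: cvg_cst.
  rewrite big_cons; under eq_fun do rewrite big_cons.
  by apply: cvgD => //; apply: cvgM; [exact: cvg_cst|exact: majorant_cvg].
apply: (cvgr_to_le h); apply: nearW => k; exact: (majorant_ok k).2.
Qed.

Lemma majorant_lim_ge0 n : 0 <= majorant_lim n.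
Proof. exact: le_trans (majorant_lim_ge 0 n). Qed.

Lemma majorant_lim_summable : rsummable majorant_lim.
Proof. exact: (weighted_rsummable w1 majorant_lim_ge0 majorant_lim_weighted). Qed.

(** The iterates converge to some [c], uniformly in time.  The distance of the
    (k+1)-st iterate to the Picard image of [c] is at most [kappa] times the
    difference of the powers of the limit majorant and of the k-th one, which
    tends to 0; hence [c] is its own Picard image. *)
Lemma solution_exists : exists c : R -> Z -> cplx R,
  [/\ forall n, deriv_on I (c^~ n) (fun t => ode_rhs omega p (c t) n),
      forall t, I t -> dominated (c t) majorant_lim &
      forall n, c 0 n = uhat n].
Proof.
have exl t n : exists l : cplx R, I t -> (fun k => iterate k t n) @ \oo --> l.
  have [It|nIt] := pselect (I t); last by exists 0.
  have [|k|k|l hl] := @telescoping_cvg _ (fun k => iterate k t n)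
    (fun k => majorant k n) rho.
  - by move=> k; exact: iterateB_le.
  - exact: majorant_le.
  - by have [_ h _] := iterate_ok k; exact: h.
  - by exists l.
have [f hf] := choice (fun tn : R * Z => exl tn.1 tn.2).
pose c t n := f (t, n).
have cl t n : I t -> (fun k => iterate k t n) @ \oo --> c t n.
  by move=> It; exact: (hf (t, n) It).
have tele t n k l : I t -> (k <= l)%N ->
    cmod (iterate l t n - iterate k t n) <= majorant l n - majorant k n.
  move=> It; elim: l => [|l IH].
    by rewrite leqn0 => /eqP ->; rewrite !subrr cmod0.
  rewrite leq_eqVlt ltnS => /predU1P[<-|kl]; first by rewrite !subrr cmod0.
  have h1 := iterateB_le l It n; have h2 := IH kl.
  rewrite -[iterate l.+1 t n](subrK (iterate l t n)) -addrA.
  apply: le_trans (cmodD _ _) _; apply: le_trans (lerD h1 h2) _.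
  by rewrite addrA subrK.
have tail t k : I t -> dominated (fun n => c t n - iterate k t n)
    (fun n => majorant_lim n - majorant k n).
  move=> It n.
  have h : (fun l => iterate l t n - iterate k t n) @ \oo -->
      (c t n - iterate k t n : cplx R).
    exact: cvg_cplxD (cl t n It) (cvg_cst _).
  apply: (cvg_cmod_le h); exists k => // l /= kl.
  by apply: le_trans (tele t n k l It kl) _; rewrite lerD2r; exact: majorant_lim_ge.
have cdom t : I t -> dominated (c t) majorant_lim.
  by move=> It n; have := tail t 0 It n; rewrite !subr0.
have sM := majorant_lim_summable.
have ccont n : {within I, continuous (c^~ n)}.
  apply/within_continuousP => t It; apply/cvg_cmodP => e e0.
  have e3 : 0 < e / 3 by rewrite divr_gt0.
  have /cvgrPdist_lt/(_ _ e3)[k _ /(_ k (leqnn k)) hk] := @majorant_cvg n.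
  have {}hk : majorant_lim n - majorant k n < e / 3.
    by apply: le_lt_trans hk; exact: ler_norm.
  have [ck _ _] := iterate_ok k.
  have /within_continuousP/(_ _ It)/cvg_cmodP/(_ _ e3) := ck n.
  apply: filterS2 (withinT _ _) => s Is h.
  have h1 := tail t k It n; have h2 := tail s k Is n.
  have -> : c t n - c s n = (c t n - iterate k t n) +
    ((iterate k t n - iterate k s n) - (c s n - iterate k s n)) by ring.
  apply: le_lt_trans (cmodD _ _) _.
  by have := cmodB (iterate k t n - iterate k s n) (c s n - iterate k s n); lra.
have stepc := picardP ccont cdom sM.
(* [c] and its Picard image are both limits of the iterates. *)
have fix_c t n : I t -> c t n = picard c t n.
  move=> It; apply: (cvg_cplx_unique (cl t n It)).
  suff h : (fun k => iterate k.+1 t n) @ \oo --> picard c t n 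
    by rewrite -(cvg_shiftS (fun k => iterate k t n : cplx R)).
  have Gcvg : (fun k => kappa * (rpow majorant_lim p.-1 n -
      rpow (majorant k) p.-1 n)) @ \oo --> (0 : R).
    rewrite -(mulr0 kappa) -(subrr (rpow majorant_lim p.-1 n)).
    apply: cvgM; first exact: cvg_cst.
    apply: cvgB; first exact: cvg_cst.
    apply: (@cvg_rpow _ _ _ _ _ majorant majorant_lim majorant_lim) => //.
    - by apply: nearW => k m; rewrite cmod_real ger0_norm ?majorant_ge0 //;
        exact: majorant_lim_ge.
    - by move=> m; rewrite cmod_real ger0_norm // majorant_lim_ge0.
    - exact: majorant_cvg.
  apply/cvg_cmodP => e e0; have /cvgrPdist_lt/(_ _ e0) := Gcvg.
  apply: filterS => k; rewrite sub0r normrN => hk.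
  have [_ dk sk] := iterate_ok k.
  apply: le_lt_trans hk; apply: le_trans (ler_norm _).
  apply: (picard_stepB_le stepc sk) It => s Is.
  exact: (rpow_domB p.-1 (dk s Is) (cdom s Is) (tail s k Is)
    (majorant_summable k) sM).
exists c; split=> // n; last by rewrite (fix_c 0 n time_itv0); have [] := stepc n.
have [h _] := stepc n.
by apply: (eq_deriv_on _ _ h) => t It; rewrite /= /ode_rhs fix_c.
Qed.

End Picard.

(** * From coefficients to classical solutions *)

Section Weight.
Variables (R : realType) (nu : nat) (omega : 'rV[R]_nu).
Local Notation Z := 'rV[int]_nu.
Implicit Types n m : Z.

Lemma absz_sub (x y : int) : (absz x <= absz y + absz (x - y)%R)%N.
Proof. lia. Qed.

Lemma l1norm_sub n m : (l1norm n <= l1norm m + l1norm (n - m))%N.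
Proof.
rewrite /l1norm -big_split leq_sum // => j _; rewrite !mxE.
exact: absz_sub.
Qed.

(** The exponent 2 pays for the two derivatives in x of the equation. *)
Definition weight n : R := (1 + (l1norm n)%:R) ^+ 2.

Lemma weight_ge1 n : 1 <= weight n.
Proof. by rewrite /weight exprn_ege1 // lerDl. Qed.

Lemma weightM n m : weight n <= weight m * weight (n - m).
Proof.
rewrite /weight -exprMn lerXn2r ?nnegrE ?mulr_ge0 ?addr_ge0 //.
have h : (l1norm n)%:R <= (l1norm m)%:R + (l1norm (n - m))%:R :> R.
  by rewrite -natrD ler_nat l1norm_sub.
have : 0 <= (l1norm m)%:R * (l1norm (n - m))%:R :> R by rewrite mulr_ge0.
by rewrite mulrDl mul1r mulrDr mulr1; lra.
Qed.

Definition freq_bound : R := 1 + \sum_j `|omega ord0 j|.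

Lemma freq_bound_ge1 : 1 <= freq_bound.
Proof. by rewrite lerDl sumr_ge0. Qed.

Lemma freq_le n : `|freq omega n| <= freq_bound * (1 + (l1norm n)%:R).
Proof.
apply: le_trans (ler_norm_sum _ _ _) _.
apply: (@le_trans _ _ (\sum_j `|omega ord0 j| * (l1norm n)%:R)).
  apply: ler_sum => j _; rewrite normrM mulrC ler_wpM2l //.
  by rewrite -intr_norm -natr_absz ler_nat /l1norm (bigD1 j) //= leq_addr.
rewrite -mulr_suml /freq_bound mulrDl mul1r mulrDr mulr1.
have : 0 <= \sum_j `|omega ord0 j| by rewrite sumr_ge0.
have : 0 <= (l1norm n)%:R :> R by [].
lra.
Qed.

Lemma freqX_le n (e : nat) : (e <= 2)%N ->
  `|freq omega n| ^+ e <= freq_bound ^+ 2 * weight n.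
Proof.
move=> e2; rewrite /weight -exprMn.
have y1 : 1 <= freq_bound * (1 + (l1norm n)%:R).
  by rewrite -[leLHS]mulr1 ler_pM ?freq_bound_ge1 // lerDl.
apply: le_trans (_ : (freq_bound * (1 + (l1norm n)%:R)) ^+ e <= _).
  by rewrite lerXn2r ?nnegrE ?freq_le // (le_trans ler01 y1).
by rewrite ler_weXn2l.
Qed.

End Weight.

Section Assembly.
Variables (R : realType) (nu : nat) (omega : 'rV[R]_nu) (p : nat) (L : R).
Hypotheses (p0 : (0 < p)%N) (L0 : 0 <= L).
Local Notation Z := 'rV[int]_nu.
Local Notation I := (`[0, L]%classic : set R).
Local Notation dx := (dx_coef omega).
Local Notation w := (weight R (nu := nu)).

Lemma cmod_dx (a : Z -> cplx R) n : cmod (dx a n) = `|freq omega n| * cmod (a n).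
Proof. by rewrite !cmodM cmod_i mul1r cmod_real. Qed.

Lemma cmod_iter_dx (a : Z -> cplx R) n e :
  cmod (iter e dx a n) = `|freq omega n| ^+ e * cmod (a n).
Proof.
elim: e => [|e IH]; first by rewrite mul1r.
by rewrite iterS cmod_dx IH exprS mulrA.
Qed.

Lemma iter_dx_le (a : Z -> cplx R) (Y : Z -> R) e : (e <= 2)%N ->
  dominated a Y ->
  dominated (iter e dx a) (fun n => freq_bound omega ^+ 2 * (w n * Y n)).
Proof.
move=> e2 aY n; rewrite cmod_iter_dx mulrA ler_pM ?cmod_ge0 ?exprn_ge0 //.
exact: freqX_le.
Qed.

Lemma deriv_qp_sum (a : Z -> cplx R) : abs_summable a -> abs_summable (dx a) ->
  deriv_on setT (qp_sum omega a) (qp_sum omega (dx a)).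
Proof.
move=> ha [C hC].
have Tint : is_interval (setT : set R) by [].
apply: (deriv_on_sum Tint _ hC (f := fun n x => a n * expi (freq omega n * x))
  (df := fun n x => dx a n * expi (freq omega n * x))).
- move=> n; have := deriv_onZ (a n) (@deriv_on_expi R setT (freq omega n)).
  apply: eq_deriv_on => // x _; rewrite /dx_coef; ring.
- by move=> n x _; rewrite cmod_qp_term.
- by move=> x _; exact: abs_summable_qp.
Qed.

Variables (uhat : Z -> cplx R) (c : R -> Z -> cplx R) (A : Z -> R) (rho : R).
Hypothesis c_ode : forall n, deriv_on I (c^~ n) (fun t => ode_rhs omega p (c t) n).
Hypothesis c_dom : forall t, I t -> dominated (c t) A.
Hypothesis A_le : sum_le (fun n => w n * A n) rho.
Hypothesis c_init : forall n, c 0 n = uhat n.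

Let dc t := ode_rhs omega p (c t).
Let Y n := 2^-1 * (A n + p%:R^-1 * rpow A p.-1 n).
Let w1 := @weight_ge1 R nu.
Let wM := @weightM R nu.

Let A0 n : 0 <= A n.
Proof. exact: dominated_ge0 (c_dom (time_itv0 L0)). Qed.

Let sA : rsummable A. Proof. exact: (weighted_rsummable w1 A0 A_le). Qed.

Let rpow_le := rpow_weighted w1 wM p.-1 A0 A_le.

Let dc_dom t : I t -> dominated (dc t) Y.
Proof.
move=> It n; rewrite !cmodM cmodN cmod_i mul1r cmod_real.
apply: ler_pM; rewrite ?cmod_ge0 ?symbol_le //.
apply: le_trans (cmodD _ _) _; rewrite cmodM cmodV cmod_nat lerD ?c_dom //.
by rewrite ler_wpM2l ?invr_ge0 //; apply: (rpow_dom p.-1 (c_dom It) sA).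
Qed.

Let Y_le : exists C, sum_le (fun n => w n * Y n) C.
Proof.
have pV : 0 <= (p%:R^-1 : R) by rewrite invr_ge0.
have half : 0 <= (2^-1 : R) by rewrite invr_ge0.
eexists; apply: sum_le_mono (sum_leZ half (sum_leD A_le (sum_leZ pV rpow_le))).
move=> n; rewrite /Y le_eqVlt; apply/orP; left; apply/eqP; ring.
Qed.

Let scaled (B : Z -> R) C : sum_le (fun n => w n * B n) C ->
  sum_le (fun n => freq_bound omega ^+ 2 * (w n * B n)) (freq_bound omega ^+ 2 * C).
Proof. by apply: sum_leZ; exact: sqr_ge0. Qed.

Let qp_uniform (a : R -> Z -> cplx R) (B : Z -> R) C e : (e <= 2)%N ->
  (forall t, I t -> dominated (a t) B) -> sum_le (fun n => w n * B n) C ->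
  abs_unif_sum (I `*` setT) (qp_term omega (fun t => iter e dx (a t)))
    (fun z => qp_sum omega (iter e dx (a z.1)) z.2).
Proof.
move=> e2 aB hB; apply: (abs_unif_sum_dominated (scaled hB)) => n [t x] [/= It _].
by rewrite /qp_term cmod_qp_term; exact: (iter_dx_le e2 (aB t It)).
Qed.

Let qp_abs (a : Z -> cplx R) (B : Z -> R) C e : (e <= 2)%N ->
  dominated a B -> sum_le (fun n => w n * B n) C -> abs_summable (iter e dx a).
Proof.
move=> e2 aB hB; exact: (abs_summable_le (iter_dx_le e2 aB) (scaled hB)).
Qed.

Let deriv_t (e : nat) x : (e <= 2)%N ->
  deriv_on I (fun t => qp_sum omega (iter e dx (c t)) x)
    (fun t => qp_sum omega (iter e dx (dc t)) x).
Proof.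
move=> e2; have [C hC] := Y_le.
apply: (deriv_on_sum (@itv_interval R L) _ (scaled hC)
  (f := fun n t => iter e dx (c t) n * expi (freq omega n * x))
  (df := fun n t => iter e dx (dc t) n * expi (freq omega n * x))).
- move=> n; pose z : cplx R := 'i%C * (freq omega n)%:C%C; pose k := z ^+ e.
  have ek (a : Z -> cplx R) : iter e dx a n = k * a n.
    rewrite /k; elim: e {e2 k} => [|e IH]; first by rewrite mul1r.
    by rewrite iterS exprS -(mulrA z) -IH.
  have := deriv_onZ (k * expi (freq omega n * x)) (@c_ode n).
  apply: eq_deriv_on => t _; rewrite ek -mulrA [RHS]mulrAC -[RHS]mulrA; congr (_ * _).
- by move=> n t It; rewrite cmod_qp_term; exact: (iter_dx_le e2 (dc_dom It)).
- move=> t It; apply: abs_summable_qp; exact: qp_abs e2 (c_dom It) A_le.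
Qed.

(** A solution of the system with one dominating family, summable against the
    weight, gives series that converge by the Weierstrass test after two
    derivatives in x, and whose derivatives may be computed termwise. *)
Lemma classical_of_coefficients :
  classical_solution omega p L (qp_sum omega uhat)
    (fun z => qp_sum omega (c z.1) z.2).
Proof.
have [C hC] := Y_le.
have sc t e : I t -> (e <= 2)%N -> abs_summable (iter e dx (c t)).
  by move=> It e2; exact: qp_abs e2 (c_dom It) A_le.
have sdc t e : I t -> (e <= 2)%N -> abs_summable (iter e dx (dc t)).
  by move=> It e2; exact: qp_abs e2 (dc_dom It) hC.
have cc n : {within I, continuous (c^~ n)} by exact: deriv_continuous (@c_ode n).
have nlE t n : I t -> nonlin_coef omega p (c t) n =
    p%:R^-1 * dx (conv_pow (c t) p.-1) n.
  by move=> It; apply: nonlin_coefE => //; [exact: (sc t 0)|exact: (sc t 1)].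
have nl_le t n : I t -> cmod (nonlin_coef omega p (c t) n) <=
    p%:R^-1 * (freq_bound omega ^+ 2 * (w n * rpow A p.-1 n)).
  move=> It; rewrite nlE // cmodM cmodV cmod_nat ler_wpM2l ?invr_ge0 //.
  exact: (@iter_dx_le _ _ 1 _ (rpow_dom p.-1 (c_dom It) sA)).
have snl t : I t -> abs_summable (nonlin_coef omega p (c t)).
  by move=> It; apply: abs_summable_iter; [exact: (sc t 0)|exact: (sc t 1)].
have nl_sum t x : I t -> qp_sum omega (nonlin_coef omega p (c t)) x =
    qp_sum omega (c t) x ^+ p.-1 * qp_sum omega (dx (c t)) x.
  by move=> It; apply: qp_sum_iter; [exact: (sc t 0)|exact: (sc t 1)].
exists (fun z => qp_sum omega (dc z.1) z.2), (fun z => qp_sum omega (dx (c z.1)) z.2),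
  (fun z => qp_sum omega (dx (dx (c z.1))) z.2),
  (fun z => qp_sum omega (dx (dx (dc z.1))) z.2), c, dc.
split.
- move=> n; split; first exact: c_ode.
  apply/within_continuousP => t It; apply: cvg_cplxM; first exact: cvg_cst.
  apply: cvg_cplxD; first by move/within_continuousP : (cc n); apply.
  apply: cvg_cplxM; first exact: cvg_cst.
  by have /within_continuousP := @conv_pow_continuous _ _ L c A p.-1 cc c_dom sA n; apply.
- exact: (qp_uniform (e := 0) _ c_dom A_le).
- exact: (qp_uniform (e := 0) _ dc_dom hC).
- exact: (qp_uniform (e := 1) _ c_dom A_le).
- exact: (qp_uniform (e := 2) _ dc_dom hC).
- have pV : 0 <= (p%:R^-1 : R) by rewrite invr_ge0.
  have h := @abs_unif_sum_dominated R nu _ (I `*` setT)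
    (qp_term omega (fun t => nonlin_coef omega p (c t))) _ _
    (sum_leZ pV (scaled rpow_le)).
  apply: (eq_abs_unif_sum _ (h _)).
    by move=> [t x] [/= It _]; exact: nl_sum.
  by move=> n [t x] [/= It _]; rewrite /qp_term cmod_qp_term; exact: nl_le.
- by move=> x; exact: (@deriv_t 0).
- move=> t tL; have It : I t by rewrite time_itvE.
  exact: deriv_qp_sum (sc t 0 It isT) (sc t 1 It isT).
- move=> t tL; have It : I t by rewrite time_itvE.
  exact: deriv_qp_sum (sc t 1 It isT) (sc t 2 It isT).
- by move=> x; exact: (@deriv_t 2).
- move=> t x tL; have It : I t by rewrite time_itvE.
  rewrite -nl_sum //=.
  rewrite (qp_sum_residual x p0 (sc t 0 It isT) (sc t 1 It isT)
    (sdc t 0 It isT) (sdc t 2 It isT) (snl t It)).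
  rewrite -[RHS](@sum0 R Z); apply: eq_sum => n.
  by rewrite subrr mulr0 mul0r.
- by move=> x /=; congr qp_sum; apply/funext.
Qed.

End Assembly.

(** * Sums over the lattice *)

Section LatticeSums.
Variable R : realType.

(** The partial sums up to N are at most 2 - 2 / (1 + N), by induction. *)
Lemma sum_le_sq : sum_le (fun k : nat => (1 + k%:R : R) ^- 2) 2.
Proof.
have main N : forall J : {fset nat}, (forall k, k \in J -> (k < N)%N) ->
    \sum_(k <- J) (1 + k%:R : R) ^- 2 <= 2 - 2 / (1 + N%:R).
  elim: N => [|N IH] J hJ.
    rewrite big_seq big1 => [|k /hJ //].
    by rewrite addr0 divr1 subrr.
  have N0 : 0 <= (N%:R : R) by [].
  have step : (1 + N%:R : R) ^- 2 <= 2 / (1 + N%:R) - 2 / (1 + N.+1%:R).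
    rewrite -[N.+1%:R]natr1; set x := N%:R in N0 *.
    have -> : 2 / (1 + x) - 2 / (1 + (x + 1)) =
        (1 + x) ^- 2 * ((1 + x) * 2 / (2 + x)).
      by field; rewrite !gt_eqF //; lra.
    by rewrite ler_peMr ?invr_ge0 ?exprn_ge0 // ?ler_pdivlMr; lra.
  have sub k : k \in (J `\ N)%fset -> (k < N)%N.
    by rewrite !inE => /andP[kN /hJ]; rewrite ltnS leq_eqVlt (negbTE kN).
  have := IH _ sub; case NJ: (N \in J).
    by rewrite [X in _ -> X <= _](big_fsetD1 N) //=; lra.
  rewrite (_ : (J `\ N)%fset = J); last first.
    by apply/fsetP => k; rewrite !inE; case: eqVneq => // ->; rewrite NJ.
  have : 0 <= (1 + N%:R : R) ^- 2 by rewrite invr_ge0 exprn_ge0.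
  lra.
move=> J; apply: le_trans (main (\max_(k <- J) k).+1 J _) _.
  by move=> k kJ; rewrite ltnS (big_fsetD1 k) //= leq_maxl.
by rewrite gerBl divr_ge0.
Qed.

(** Negative integers contribute at most 1: their absolute values miss 0, whose
    term is 1. *)
Lemma sum_le_int : sum_le (fun t : int => (1 + (absz t)%:R : R) ^- 2) 3.
Proof.
pose M k : R := (1 + k%:R) ^- 2.
move=> T; rewrite (big_fsetID _ (fun t : int => 0 <= t)) /=.
set P := [fset _ | _ in _ & _]%fset; set N := [fset _ | _ in _ & _]%fset.
have -> : \sum_(t <- P) (1 + (absz t)%:R : R) ^- 2 =
    \sum_(k <- [fset absz t | t in P]%fset) M k.
  rewrite [RHS]big_imfset // => x y; rewrite !inE /= => /andP[_ hx] /andP[_ hy].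
  by move: hx hy; lia.
have -> : \sum_(t <- N) (1 + (absz t)%:R : R) ^- 2 =
    \sum_(k <- [fset absz t | t in N]%fset) M k.
  rewrite [RHS]big_imfset // => x y; rewrite !inE /= => /andP[_ hx] /andP[_ hy].
  by move: hx hy; lia.
have h1 := sum_le_sq [fset absz t | t in P]%fset.
have := sum_le_sq (0%N |` [fset absz t | t in N])%fset.
rewrite big_fsetU1 /=; last first.
  apply/imfsetP => -[t]; rewrite !inE /= => /andP[_ ht] e.
  by move: ht e; lia.
rewrite /M addr0 expr1n invr1; move: h1; rewrite /M; lra.
Qed.

Variable nu : nat.
Local Notation Z := 'rV[int]_nu.

(** A finite set of lattice points lies in a box T^nu, over which the sum of
    products is a product of sums. *)
Lemma sum_le_lattice (g : int -> R) C : (forall t, 0 <= g t) -> sum_le g C ->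
  sum_le (fun n : Z => \prod_j g (n ord0 j)) (C ^+ nu).
Proof.
move=> g0 gC J.
pose T := \big[fsetU/fset0]_(j : 'I_nu) [fset (n : Z) ord0 j | n in J]%fset.
have hT n j : n \in J -> n ord0 j \in T.
  move=> nJ; rewrite /T (bigD1 j) //= inE; apply/orP; left.
  by apply/imfsetP; exists n.
have T_le : \sum_(t : T) g (val t) <= C 
  by rewrite -[X in X <= _]/(partial_sum g T) partial_sumE; exact: gC.
have T_ge0 : 0 <= \sum_(t : T) g (val t) by rewrite sumr_ge0.
have -> : C ^+ nu = \prod_(j < nu) C by rewrite prodr_const card_ord.
apply: (@le_trans _ _ (\prod_(j < nu) \sum_(t : T) g (val t))); last first.
  by apply: ler_prod => j _; rewrite T_ge0.
rewrite bigA_distr_bigA /=.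
pose row (f : {ffun 'I_nu -> T}) : Z := \row_j val (f j).
have rowI : injective row.
  move=> f f' /rowP e; apply/ffunP => j; apply: val_inj.
  by have := e j; rewrite !mxE.
rewrite (eq_bigr (fun f => \prod_j g (row f ord0 j))); last first.
  by move=> f _; apply: eq_bigr => j _; rewrite mxE.
have -> : \sum_(f : {ffun 'I_nu -> T}) \prod_j g (row f ord0 j) =
    \sum_(n <- [fset row f | f in {ffun 'I_nu -> T}]%fset) \prod_j g (n ord0 j).
  by rewrite big_imfset //= => [|f f' _ _ /rowI //]; rewrite big_enum.
apply: sum_le_sub => [n|]; first by rewrite prodr_ge0.
apply/fsubsetP => n nJ; apply/imfsetP.
exists [ffun j => [` hT n j nJ]%fset] => //=.
by apply/rowP => j; rewrite mxE ffunE.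
Qed.

End LatticeSums.

(** * The constants of the theorem *)

Section Constants.
Variable R : realType.

Lemma zeta_ge0 (s : R) : 0 <= zeta s.
Proof.
rewrite /zeta; have [c|/dvgP ->] := pselect (cvgn (series (fun k : nat => k.+1%:R `^ (- s)))).
  apply: limr_ge => //; apply: nearW => n; rewrite /series /=.
  by apply: sumr_ge0 => k _; exact: powR_ge0.
(* The limit of a divergent sequence is the default point, which is 0. *)
exact: lexx.
Qed.

Lemma bfrak_ge1 (s : R) nu : 1 <= bfrak s nu.
Proof.
rewrite lerDl; apply: sumr_ge0 => j _.
by rewrite !mulr_ge0 ?powR_ge0 ?exprn_ge0 ?zeta_ge0.
Qed.

Lemma bernoulli_le (x : R) k : 0 <= x -> (1 + x) ^+ k * (1 - k%:R * x) <= 1.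
Proof.
move=> x0; elim: k => [|k IH]; first by rewrite mul0r subr0 mulr1.
apply: le_trans IH; rewrite exprSr -mulrA ler_wpM2l ?exprn_ge0 ?addr_ge0 //.
rewrite -natr1; have : 0 <= k%:R * x ^+ 2 by rewrite mulr_ge0 ?sqr_ge0.
have := sqr_ge0 x; nra.
Qed.

(** Bernoulli's inequality with (p - 1) / (2 p) <= 1 / 2. *)
Lemma decay_const_power_le2 (p : nat) : (2 <= p)%N ->
  (1 + (2 * p)%:R^-1 : R) ^+ p.-1 <= 2.
Proof.
move=> p2; have p0 : 0 < (p%:R : R) by rewrite ltr0n; lia.
have x0 : 0 <= ((2 * p)%:R^-1 : R) by rewrite invr_ge0.
have := bernoulli_le p.-1 x0; set y := _ ^+ _ => h.
have y0 : 0 <= y by rewrite exprn_ge0 ?addr_ge0.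
have h2 : (p.-1%:R : R) * (2 * p)%:R^-1 <= 2^-1.
  rewrite natrM invfM mulrCA ler_piMr ?invr_ge0 // ler_pdivrMr // mul1r ler_nat.
  by lia.
nra.
Qed.

(** Since 3^5 = 243 <= 256 = 2^8. *)
Lemma three_powR (k : nat) : 3 ^+ k <= 2 `^ (8 / 5 * k%:R) :> R.
Proof.
rewrite powRrM powR_mulrn ?powR_ge0 // lerXn2r ?nnegrE ?powR_ge0 //.
have : (3 : R) ^+ 5 <= (2 `^ (8 / 5)) ^+ 5.
  rewrite -[leRHS]powR_mulrn ?powR_ge0 // -powRrM divfK //.
  by rewrite (_ : 8 = 8%:R :> R) // powR_mulrn // -!natrX ler_nat.
by rewrite ler_pXn2r ?nnegrE ?powR_ge0.
Qed.

Variable nu : nat.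
Local Notation Z := 'rV[int]_nu.

Lemma l1norm_eq0 (n : Z) : (l1norm n == 0%N) = (n == 0).
Proof.
apply/idP/eqP => [|->]; last first.
  by rewrite /l1norm big1 // => j _; rewrite mxE.
rewrite /l1norm sum_nat_eq0 => /forallP h; apply/rowP => j.
by have := h j; rewrite mxE absz_eq0 => /eqP.
Qed.

(** Away from the origin 1 + |n| >= 2, so the powers in excess of 2 + 2 nu are
    bounded by powers of 2; the remaining (1 + |n|)^(- 2 nu) is dominated by a
    product of one-dimensional summable families. *)
Lemma weight_decay_le (r : R) (n : Z) : 2 + 2 * nu%:R <= r ->
  weight R n * (1 + (l1norm n)%:R) `^ (- r) <=
  (n == 0)%:R + 2 `^ (- (r - 2 - 2 * nu%:R)) *
    \prod_j (1 + (absz (n ord0 j))%:R : R) ^- 2.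
Proof.
move=> hr; have prod0 : 0 <= \prod_j (1 + (absz (n ord0 j))%:R : R) ^- 2.
  by apply: prodr_ge0 => j _; rewrite invr_ge0 exprn_ge0.
have [n0|n0] := eqVneq n 0.
  have l0 : l1norm n = 0%N by apply/eqP; rewrite l1norm_eq0 n0.
  by rewrite /weight l0 addr0 expr1n powR1 mul1r lerDl mulr_ge0 ?powR_ge0.
rewrite add0r; set b := 1 + (l1norm n)%:R : R.
have b2 : 2 <= b.
  by rewrite /b -(natrD _ 1 (l1norm n)) ler_nat add1n ltnS lt0n l1norm_eq0.
have b0 : 0 < b by apply: lt_le_trans b2.
have bN0 : b != 0 by rewrite gt_eqF.
have -> : weight R n * b `^ (- r) =
    b `^ (- (r - 2 - 2 * nu%:R)) * b `^ (- (2 * nu%:R)).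
  rewrite /weight -/b -(powR_mulrn 2) ?ltW // -!powRD ?bN0 ?implybT //.
  by congr (_ `^ _); ring.
apply: ler_pM; rewrite ?powR_ge0 //.
  rewrite !powRN lef_pV2 ?posrE ?powR_gt0 // ge0_ler_powR ?nnegrE ?(ltW b0) //.
  lra.
have -> : b `^ (- (2 * nu%:R)) = \prod_(j < nu) b ^- 2.
  by rewrite prodr_const card_ord powRN -natrM powR_mulrn ?ltW // exprM exprVn.
apply: ler_prod => j _; rewrite invr_ge0 exprn_ge0 ?(ltW b0) //=.
have nj0 : 0 < 1 + (absz (n ord0 j))%:R :> R by rewrite ltr_pwDl.
rewrite lef_pV2 ?posrE ?exprn_gt0 // lerXn2r ?nnegrE ?(ltW nj0) ?(ltW b0) //.
by rewrite lerD2l ler_nat /l1norm (bigD1 j) //= leq_addr.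
Qed.

(** The origin contributes 1.  The rest is at most 2^(2 + 2 nu - r) 3^nu, which
    tends to 0 as [r] grows, uniformly in the dimension, because r > 4 nu + 8
    and 3^nu <= 2^(8 nu / 5). *)
Lemma weight_decay_sum (p : nat) (r : R) : (0 < p)%N ->
  20 * p%:R <= r -> nu%:R < r / 4 - 2 ->
  sum_le (fun n : Z => weight R n * (1 + (l1norm n)%:R) `^ (- r))
    (1 + (2 * p)%:R^-1).
Proof.
move=> p0 rp rnu; have nu0 : 0 <= (nu%:R : R) by [].
have hr : 2 + 2 * nu%:R <= r by lra.
set d := 2 `^ (- (r - 2 - 2 * nu%:R)) : R.
have d0 : 0 <= d by exact: powR_ge0.
have g0 (t : int) : 0 <= (1 + (absz t)%:R : R) ^- 2.
  by rewrite invr_ge0 exprn_ge0.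
have h1 : sum_le (fun n : Z => (n == 0)%:R) (1 : R).
  move=> J; have [J0|J0] := boolP (0 \in J).
    rewrite (big_fsetD1 0) //= eqxx big_seq big1 ?addr0 // => n.
    by rewrite !inE => /andP[/negbTE ->].
  rewrite big_seq big1 ?ler01 // => n nJ.
  by case: eqVneq nJ J0 => // -> ->.
have h2 := sum_le_lattice (nu := nu) g0 (@sum_le_int R).
have h := sum_leD h1 (sum_leZ d0 h2).
move=> J; apply: le_trans (_ : 1 + d * 3 ^+ nu <= _).
  by apply: le_trans (h J); apply: ler_sum => n _; exact: weight_decay_le.
rewrite lerD2l; apply: le_trans (ler_wpM2l d0 (three_powR nu)) _.
rewrite -powRD; last by rewrite pnatr_eq0 implybT.
apply: (@le_trans _ _ (2 `^ (- (2 * p)%:R))).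
  by apply: ler_powR; rewrite ?ler1n // natrM; lra.
rewrite powRN powR_mulrn // lef_pV2 ?posrE ?exprn_gt0 ?ltr0n ?muln_gt0 //.
by rewrite -natrX ler_nat ltnW // ltn_expl.
Qed.

End Constants.

Section Radius.
Variable R : realType.

Lemma lifespan_ge0 (p nu : nat) (A r : R) : (0 < p)%N -> 0 < A ->
  0 <= lifespan p nu A r.
Proof.
move=> p0 A0; have b0 : 0 < bfrak (r / 2) nu.
  by apply: lt_le_trans (bfrak_ge1 _ _).
rewrite /lifespan !mulr_ge0 ?invr_ge0 ?(ltW A0) ?(ltW b0) // exprn_ge0 //.
by rewrite subr_ge0 invf_le1 ?ltr0n // ler1n.
Qed.

(** The factor (1 - 1/p)^(p-1) of the lifespan is designed for a ball whose
    radius is p / (p-1) times the norm of the data: the hypothesis on [S] and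
    [bfrak >= 1] bound the nonlinear contribution by [rho / p], which is what
    the data leave free. *)
Lemma picard_radius (p nu : nat) (A r S : R) : (2 <= p)%N -> 0 < A ->
  0 <= S -> S ^+ p.-1 <= 2 ->
  let y0 := A `^ (p.-1%:R^-1) * S in
  let rho := y0 / (1 - p%:R^-1) in
  0 <= rho /\ y0 + kappa p (lifespan p nu A r) * rho ^+ p <= rho.
Proof.
move=> p2 A0 S0 S2 y0 rho.
have p0 : 0 < (p%:R : R) by rewrite ltr0n; lia.
have q0 : (p.-1%:R : R) != 0 by rewrite pnatr_eq0; lia.
set t := 1 - (p%:R : R)^-1.
have t0 : 0 < t by rewrite subr_gt0 invf_lt1 // ltr1n.
have y00 : 0 <= y0 by rewrite mulr_ge0 ?powR_ge0.
have rho0 : 0 <= rho by rewrite divr_ge0 // ltW.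
split=> //.
have b1 := bfrak_ge1 (r / 2) nu; set b := bfrak _ _ in b1.
have b0 : 0 < b by apply: lt_le_trans b1.
have y0X : y0 ^+ p.-1 = A * S ^+ p.-1.
  by rewrite exprMn -(powR_mulrn p.-1 (powR_ge0 A _)) -powRrM mulVf // powRr1 // ltW.
have Lrho : lifespan p nu A r * rho ^+ p.-1 <= 2.
  rewrite /lifespan -/t -/b /rho -/t expr_div_n y0X.
  have tX : t ^+ p.-1 != 0 by rewrite expf_neq0 // gt_eqF.
  have -> : t ^+ p.-1 / A / b * (A * S ^+ p.-1 / t ^+ p.-1) = S ^+ p.-1 / b.
    by field; rewrite tX !gt_eqF.
  rewrite ler_pdivrMr //; apply: le_trans S2 _.
  by rewrite ler_peMr.
have -> : y0 = rho - rho / p%:R.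
  have -> : rho - rho / p%:R = rho * t by rewrite /t; ring.
  by rewrite /rho divfK // gt_eqF.
have -> : kappa p (lifespan p nu A r) * rho ^+ p =
    (lifespan p nu A r * rho ^+ p.-1) * (rho / p%:R) * 2^-1.
  have -> : rho ^+ p = rho * rho ^+ p.-1 by rewrite -exprS prednK // ltnW.
  by rewrite /kappa; ring.
have : (lifespan p nu A r * rho ^+ p.-1) * (rho / p%:R) <= 2 * (rho / p%:R).
  by rewrite ler_wpM2r // divr_ge0 // ltW.
lra.
Qed.

End Radius.

Theorem theoremB (R : realType) (p : nat) (hp : (2 <= p)%N) :
  exists r0 : R,
  forall (nu : nat) (omega : 'rV[R]_nu) (A r : R)
         (uhat : 'rV[int]_nu -> cplx R),
  (1 <= nu)%N ->
  nonresonant omega ->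
  0 < A ->
  r0 <= r ->
  nu%:R < r / 4 - 2 ->
  (forall n : 'rV[int]_nu,
     cmod (uhat n) <= A `^ (p.-1%:R^-1) * (1 + (l1norm n)%:R) `^ (- r)) ->
  exists2 u : R * R -> cplx R,
    classical_solution omega p (lifespan p nu A r) (qp_sum omega uhat) u &
    forall v : R * R -> cplx R,
      classical_solution omega p (lifespan p nu A r) (qp_sum omega uhat) v ->
      forall t x : R, 0 <= t <= lifespan p nu A r -> v (t, x) = u (t, x).
Proof.
(* 20 p makes 2^(- r / 10) at most 2^(- 2 p), hence the sum of the decaying
   weights at most 1 + 1 / (2 p). *)
exists (20 * p%:R) => nu omega A r uhat _ nr A0 hr hnu hu.
have p0 : (0 < p)%N by lia.
have L0 := lifespan_ge0 nu r p0 A0.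
pose S : R := 1 + (2 * p)%:R^-1.
have S0 : 0 <= S by rewrite addr_ge0 ?invr_ge0.
have [rho0 rho_le] := picard_radius nu r hp A0 S0 (decay_const_power_le2 R hp).
have y_le : sum_le (fun n => weight R n * cmod (uhat n))
    (A `^ (p.-1%:R^-1) * S).
  have := sum_leZ (powR_ge0 A (p.-1%:R^-1)) (weight_decay_sum p0 hr hnu).
  apply: sum_le_mono => n; rewrite mulrCA ler_wpM2l //.
  exact: le_trans ler01 (weight_ge1 R n).
have [c [c_ode c_dom c_init]] := solution_exists omega p0 L0
  (@weight_ge1 R nu) (@weightM R nu) y_le rho0 rho_le.
have A_le := majorant_lim_weighted omega p0 L0
  (@weight_ge1 R nu) (@weightM R nu) y_le rho0 rho_le.
have sol := classical_of_coefficients p0 L0 c_ode c_dom A_le c_init.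
exists (fun z => qp_sum omega (c z.1) z.2) => // v hv t x tL.
exact: classical_solution_unique sol hv t x tL.
Qed.
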